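(* Let $R$ and $S$ be two super rings. Then the isomorphism classes of category equivalences $\mathfrak{M}_S\to\mathfrak{M}_R$ are in one-to-one correspondence with the isomorphism classes of $(S,R)$-progenerators, an $(S,R)$-progenerator $P$ corresponding to the functor $-\otimes_S P$. Composition of category equivalences corresponds to tensor products of these progenerators: if $T$ is a further super ring, and the equivalences $\mathfrak{M}_S\to\mathfrak{M}_R$ and $\mathfrak{M}_R\to\mathfrak{M}_T$ correspond to an $(S,R)$-progenerator $P$ and an $(R,T)$-progenerator $P'$, then their composite $\mathfrak{M}_S\to\mathfrak{M}_T$ corresponds to $P\otimes_R P'$.
   Context: A super ring is an associative (not necessarily commutative) unital ring $R=R_0\oplus R_1$ graded by $\mathbb{Z}_2$ with $R_iR_j\subseteq R_{i+j}$. All modules and bimodules are $\mathbb{Z}_2$-graded with actions compatible with the grading; $|x|$ is the parity of a homogeneous element. $\mathfrak{M}_R$ is the category of right graded $R$-modules whose morphisms $Hom_R(M,N)$ are the parity-preserving $R$-module homomorphisms. Isomorphisms of bimodules are parity-preserving; isomorphism of functors is natural isomorphism. For right modules, $\underline{Hom}_R(M,N)$ is the $\mathbb{Z}_2$-graded abelian group of all $R$-linear maps (even part: parity-preserving, odd part: parity-reversing). For left modules, $\underline{Hom}_R(M,N)$ is the $\mathbb{Z}_2$-graded group whose homogeneous elements $f$ satisfy $f(rx)=(-1)^{|r||f|}rf(x)$. $\underline{End}$ is $\underline{Hom}$ of a module to itself, a super ring under composition. The opposite $R^o$ of a super ring has multiplication $x\cdot_o y=(-1)^{|x||y|}yx$.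 $(SAb)$ is the category of $\mathbb{Z}_2$-graded abelian groups with parity-preserving homomorphisms. $P\in\mathfrak{M}_R$ is projective if $Hom_R(P,-)$ is exact; it is a generator if $\underline{Hom}_R(P,-):\mathfrak{M}_R\to(SAb)$ is faithful, i.e. for each morphism $f:M\to N$ in $\mathfrak{M}_R$, $f_*=0$ implies $f=0$; a progenerator is a finitely generated projective generator. For super rings $A,B$, an $(A,B)$-bimodule $C$ is faithfully balanced if the natural maps $A\to\underline{End}(C_B)$, $a\mapsto(c\mapsto ac)$, and $B\to\underline{End}({}_AC)^o$, $b\mapsto(c\mapsto(-1)^{|b||c|}cb)$, are both isomorphisms of super rings. An $(S,R)$-bimodule $P$ is an $(S,R)$-progenerator if it is faithfully balanced and $P_R$ is a progenerator in $\mathfrak{M}_R$. Tensor products carry the grading $(M\otimes_R N)_k=\bigoplus_{i+j=k}M_i\otimes_R N_j$.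
   Formalization: Category equivalences are required to act also on odd homomorphisms (additively, preserving parity), and isomorphisms of functors to be natural for odd homomorphisms too; with parity-preserving homomorphisms alone the correspondence is neither surjective nor injective. *)

(* Defs.v *)
From HB Require Import structures.
From mathcomp Require Import all_boot all_order all_algebra.
From mathcomp Require Import boolp functions.
From mathcomp Require Import freeg.

Set Implicit Arguments.
Unset Strict Implicit.
Unset Printing Implicit Defensive.

Import GRing.Theory.
Local Open Scope ring_scope.
Local Open Scope quotient_scope.

(* Parities are booleans: false is 0, true is 1, so i (+) j is i + j mod 2 and
   i && j is the product i j. *)
Record grading (M : zmodType) := Grading {
  gpart :> bool -> zmodClosed M;
  gpart_direct : forall x : M, exists! p : M * M,
    [/\ p.1 \in gpart false, p.2 \in gpart true & x = p.1 + p.2] }.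

Section GradingTheory.
Variables (M : zmodType) (A : grading M).
Implicit Types (x y : M) (i j : bool).

Definition gproj (i : bool) (x : M) : M :=
  let p := sval (cid (gpart_direct A x)) in if i then p.2 else p.1.

Lemma gprojP i x : gproj i x \in A i.
Proof. by rewrite /gproj; case: cid => p [[]] /=; case: i. Qed.

Lemma gproj_sum x : x = gproj false x + gproj true x.
Proof. by rewrite /gproj; case: cid => p [[]]. Qed.

Lemma gproj_uniq a b i : a \in A false -> b \in A true ->
  gproj i (a + b) = if i then b else a.
Proof.
move=> aA bA; rewrite /gproj; case: cid => p [pP pu] /=.
by rewrite (pu (a, b)).
Qed.

Lemma gproj_is_additive i : zmod_morphism (gproj i).
Proof.
move=> x y; rewrite {1}(gproj_sum x) {1}(gproj_sum y) opprD addrACA.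
by rewrite gproj_uniq ?rpredB ?gprojP //; case: i.
Qed.
HB.instance Definition _ i :=
  GRing.isZmodMorphism.Build M M (gproj i) (gproj_is_additive i).

Lemma gproj_id i j x : x \in A i -> gproj j x = if j == i then x else 0.
Proof.
case: i => [|] xA; first by rewrite -{1}[x]add0r gproj_uniq ?rpred0 //; case: j.
by rewrite -{1}[x]addr0 gproj_uniq ?rpred0 //; case: j.
Qed.

Lemma gpart_disj i j x : i != j -> x \in A i -> x \in A j -> x = 0.
Proof.
move=> ij xi xj; have := gproj_id i xi.
by rewrite eqxx (gproj_id i xj) (negPf ij) => <-.
Qed.

Lemma homog_eq (N : zmodType) (f g : M -> N) :
  {morph f : x y / x + y} -> {morph g : x y / x + y} ->
  (forall i x, x \in A i -> f x = g x) -> f =1 g.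
Proof.
move=> fD gD fg x; rewrite (gproj_sum x) fD gD.
by congr (_ + _); apply: fg; exact: gprojP.
Qed.

End GradingTheory.
Arguments gproj : simpl never.

Lemma grading_mk (M : zmodType) (A : bool -> zmodClosed M) :
    (forall x, x \in A false -> x \in A true -> x = 0) ->
    (forall x, exists a b, [/\ a \in A false, b \in A true & x = a + b]) ->
  forall x : M, exists! q : M * M,
    [/\ q.1 \in A false, q.2 \in A true & x = q.1 + q.2].
Proof.
move=> A01 dA x; have [a [b [aA bA ->]]] := dA x.
exists (a, b); split=> // -[c d] /= [cA dA' E].
have E2 : a - c = d - b by rewrite -{1}(addrK b a) E addrAC [c + d]addrC addrK.
have ac : a - c = 0 by apply: A01; [|rewrite E2]; apply: rpredB.
move/eqP: (ac); rewrite subr_eq0 => /eqP ->.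
by move: E2; rewrite ac => /esym/eqP; rewrite subr_eq0 => /eqP ->.
Qed.

Record superAb := SuperAb {
  sa_zmod :> zmodType;
  sa_grad : grading sa_zmod }.

Definition evenpart (A : superAb) : Type := {x : A | x \in sa_grad A false}.
HB.instance Definition _ (A : superAb) := SubChoice.on (evenpart A).
HB.instance Definition _ (A : superAb) :=
  [SubChoice_isSubZmodule of evenpart A by <:].

Record superRing := SuperRing {
  sr_ring :> pzRingType;
  sr_grad : grading sr_ring;
  sr_gradM : forall i j x y, x \in sr_grad i -> y \in sr_grad j ->
    x * y \in sr_grad (i (+) j) }.

Definition super_ring_iso (A B : superRing) (f : A -> B) : Prop :=
  [/\ zmod_morphism f, monoid_morphism f, bijective f &
      forall i x, x \in sr_grad A i -> f x \in sr_grad B i].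

Lemma zmod_morphD (U V : zmodType) (f : U -> V) : zmod_morphism f ->
  {morph f : x y / x + y}.
Proof.
move=> fB; have f0 : f 0 = 0 by rewrite -[0 in LHS](subrr 0) fB subrr.
by move=> y z; rewrite -{1}[z]opprK fB -[- z]add0r fB f0 sub0r opprK.
Qed.

Lemma morphD0 (U V : zmodType) (f : U -> V) :
  {morph f : x y / x + y} -> f 0 = 0.
Proof. by move=> fD; apply: (addIr (f 0)); rewrite -fD !add0r. Qed.

Lemma morphDB (U V : zmodType) (f : U -> V) :
  {morph f : x y / x + y} -> zmod_morphism f.
Proof. by move=> fD x y; apply: (addIr (f y)); rewrite -fD !subrK. Qed.

(* (-1)^(ij) x *)
Definition ksgn (M : zmodType) (i j : bool) (x : M) : M :=
  if i && j then - x else x.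

Arguments ksgn : simpl never.

Lemma ksgnD (M : zmodType) i j : {morph @ksgn M i j : x y / x + y}.
Proof. by move=> x y; rewrite /ksgn; case: ifP; rewrite ?opprD. Qed.

Lemma ksgn_add (M N : zmodType) (f : M -> N) i j x : zmod_morphism f ->
  f (ksgn i j x) = ksgn i j (f x).
Proof.
by move=> fB; rewrite /ksgn; case: ifP => // _; rewrite -sub0r fB -[0 in X in f X](subrr 0) fB subrr sub0r.
Qed.

Lemma mem_ksgn (M : zmodType) (A : zmodClosed M) i j x :
  x \in A -> ksgn i j x \in A.
Proof. by move=> xA; rewrite /ksgn; case: ifP; rewrite ?rpredN. Qed.

Lemma sr_grad1 (R : superRing) : 1 \in sr_grad R false.
Proof.
set D := sr_grad R; set e := gproj D false 1; set o := gproj D true 1.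
have oE : forall i (x : R), x \in D i -> x * o = 0.
  move=> i x xD; have := mulr1 x; rewrite (gproj_sum D 1) mulrDr -/e -/o.
  have eD := sr_gradM xD (gprojP D false 1).
  have oD := sr_gradM xD (gprojP D true 1).
  rewrite -/D -/e -/o addbF addbT in eD oD.
  move=> /(congr1 (gproj D (~~ i))).
  rewrite raddfD /= (gproj_id _ eD) (gproj_id _ oD) (gproj_id _ xD) eqxx.
  by case: (i) => /=; rewrite add0r.
have o0 : o = 0.
  by rewrite -[o]mul1r (gproj_sum D 1) mulrDl !(oE _ _ (gprojP D _ _)) addr0.
by rewrite (gproj_sum D 1) -/o o0 addr0 gprojP.
Qed.

(* The opposite super ring: x .o y = (-1)^(|x||y|) y x on homogeneous x, y,
   extended biadditively. *)
Section Opposite.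
Variable R : superRing.
Let D := sr_grad R.

Definition sopp_car : Type := R.
HB.instance Definition _ := GRing.Zmodule.on sopp_car.

Definition sopp_mul (x y : sopp_car) : sopp_car :=
  \sum_(i : bool) \sum_(j : bool) ksgn i j (gproj D j y * gproj D i x : R).

Lemma sopp_mulDl : left_distributive sopp_mul +%R.
Proof.
move=> x y z; rewrite /sopp_mul -big_split; apply: eq_bigr => i _ /=.
by rewrite -big_split; apply: eq_bigr => j _ /=; rewrite raddfD mulrDr ksgnD.
Qed.

Lemma sopp_mulDr : right_distributive sopp_mul +%R.
Proof.
move=> x y z; rewrite /sopp_mul -big_split; apply: eq_bigr => i _ /=.
by rewrite -big_split; apply: eq_bigr => j _ /=; rewrite raddfD mulrDl ksgnD.
Qed.

Lemma sopp_mulE i j (x y : sopp_car) : x \in D i -> y \in D j ->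
  sopp_mul x y = ksgn i j (y * x : R).
Proof.
move=> xD yD; rewrite /sopp_mul !big_bool /= !(gproj_id _ xD) !(gproj_id _ yD).
by case: i j {xD yD} => -[] /=; rewrite /ksgn /= ?(mulr0, mul0r, oppr0, addr0, add0r).
Qed.

Lemma sopp_gradM i j (x y : sopp_car) : x \in D i -> y \in D j ->
  sopp_mul x y \in D (i (+) j).
Proof.
move=> xD yD; rewrite (sopp_mulE xD yD) mem_ksgn // addbC.
exact: sr_gradM.
Qed.

Lemma sopp_mulA : associative sopp_mul.
Proof.
move=> x y z; move: x; apply: (homog_eq (A := D)).
- by move=> x x'; rewrite sopp_mulDl.
- by move=> x x'; rewrite !sopp_mulDl.
move=> i x xD; move: y; apply: (homog_eq (A := D)).
- by move=> y y'; rewrite sopp_mulDl sopp_mulDr.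
- by move=> y y'; rewrite sopp_mulDr sopp_mulDl.
move=> j y yD; move: z; apply: (homog_eq (A := D)).
- by move=> z z'; rewrite !sopp_mulDr.
- by move=> z z'; rewrite sopp_mulDr.
move=> k z zD.
rewrite (sopp_mulE xD (sopp_gradM yD zD)) (sopp_mulE (sopp_gradM xD yD) zD).
rewrite (sopp_mulE xD yD) (sopp_mulE yD zD) /ksgn.
by case: i j k {xD yD zD} => -[] [] /=; rewrite ?(mulrN, mulNr, opprK) mulrA.
Qed.

Lemma sopp_mul1r : left_id (1 : R) sopp_mul.
Proof.
apply: (homog_eq (A := D)) => [x y||i x xD] //; first by rewrite sopp_mulDr.
by rewrite (sopp_mulE (sr_grad1 R) xD) mulr1.
Qed.

Lemma sopp_mulr1 : right_id (1 : R) sopp_mul.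
Proof.
apply: (homog_eq (A := D)) => [x y||i x xD] //; first by rewrite sopp_mulDl.
by rewrite (sopp_mulE xD (sr_grad1 R)) mul1r /ksgn andbF.
Qed.

HB.instance Definition _ := GRing.Zmodule_isPzRing.Build sopp_car
  sopp_mulA sopp_mul1r sopp_mulr1 sopp_mulDl sopp_mulDr.

Definition sopp : superRing := @SuperRing sopp_car D sopp_gradM.
End Opposite.

(* Right R-modules are left modules over the converse ring R^c, so that
   (r : R^c) *: x is the right action x r. *)
Record rmod (R : superRing) := Rmod {
  rm_lmod :> lmodType R^c;
  rm_grad : grading rm_lmod;
  rm_gradM : forall i j x (r : R), x \in rm_grad i -> r \in sr_grad R j ->
    (r : R^c) *: x \in rm_grad (i (+) j) }.

Record lmod (S : superRing) := Lmod {
  lm_lmod :> lmodType S;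
  lm_grad : grading lm_lmod;
  lm_gradM : forall i j (s : S) x, s \in sr_grad S i -> x \in lm_grad j ->
    s *: x \in lm_grad (i (+) j) }.

(* An (S, R)-bimodule is a right R-module with a commuting left S-action. *)
Record bimod (S R : superRing) := Bimod {
  bm_right :> rmod R;
  lact : S -> bm_right -> bm_right;
  lactA : forall s t x, lact s (lact t x) = lact (s * t) x;
  lact1 : forall x, lact 1 x = x;
  lactDr : forall s, {morph lact s : x y / x + y};
  lactDl : forall x, {morph lact ^~ x : s t / s + t};
  lact_ract : forall s x (r : R), lact s ((r : R^c) *: x) = (r : R^c) *: lact s x;
  lact_grad : forall i j s x, s \in sr_grad S i -> x \in rm_grad bm_right j ->
    lact s x \in rm_grad bm_right (i (+) j) }.

Section BimodLeft.
Variables (S R : superRing) (P : bimod S R).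

Definition bm_car : Type := P.
HB.instance Definition _ := GRing.Zmodule.on bm_car.
HB.instance Definition _ := GRing.Zmodule_isLmodule.Build S bm_car
  (@lactA S R P) (@lact1 S R P) (@lactDr S R P) (@lactDl S R P).

Definition bm_left : lmod S := @Lmod S bm_car (rm_grad P) (@lact_grad S R P).
End BimodLeft.

Section LinearZmod.
Variables (R : pzRingType) (U V : lmodType R).
Implicit Types f g h : {linear U -> V}.

Lemma linear_ext f g : f =1 g -> f = g.
Proof.
case: f g => [f [[mf] [sf]]] [g [[mg] [sg]]] /= /funext fg; subst g.
by rewrite (Prop_irrelevance mf mg) (Prop_irrelevance sf sg).
Qed.

HB.instance Definition _ := gen_eqMixin {linear U -> V}.
HB.instance Definition _ := gen_choiceMixin {linear U -> V}.

Definition linD f g : {linear U -> V} := f \+ g.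
Definition linN f : {linear U -> V} := \- f.
Definition lin0 : {linear U -> V} := \0.

Lemma linDA : associative linD.
Proof. by move=> f g h; apply: linear_ext => x /=; rewrite addrA. Qed.
Lemma linDC : commutative linD.
Proof. by move=> f g; apply: linear_ext => x /=; rewrite addrC. Qed.
Lemma lin0D : left_id lin0 linD.
Proof. by move=> f; apply: linear_ext => x /=; rewrite add0r. Qed.
Lemma linND : left_inverse lin0 linN linD.
Proof. by move=> f; apply: linear_ext => x /=; rewrite addNr. Qed.
HB.instance Definition _ :=
  GRing.isZmodule.Build {linear U -> V} linDA linDC lin0D linND.

Lemma lin_addE f g x : (f + g : {linear U -> V}) x = f x + g x.
Proof. by []. Qed.
Lemma lin_oppE f x : (- f : {linear U -> V}) x = - f x.
Proof. by []. Qed.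

End LinearZmod.

(* f has parity i: it sends M_j to N_(i+j). *)
Definition has_parity (M N : zmodType) (A : grading M) (B : grading N) (i : bool)
  (f : M -> N) : Prop := forall j x, x \in A j -> f x \in B (i (+) j).

Section Parity.
Variables (M N : zmodType) (A : grading M) (B : grading N).
Implicit Types f g : M -> N.

Lemma has_parityB i f g : has_parity A B i f -> has_parity A B i g ->
  has_parity A B i (fun x => f x - g x).
Proof. by move=> fP gP j x xA; rewrite rpredB ?fP ?gP. Qed.

Lemma has_parity0 i : has_parity A B i (fun=> 0).
Proof. by move=> j x _; rewrite rpred0. Qed.

Definition part_fun i f x : N := \sum_(j : bool) gproj B (i (+) j) (f (gproj A j x)).

Lemma part_funE i j f x : f 0 = 0 -> x \in A j ->
  part_fun i f x = gproj B (i (+) j) (f x).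
Proof.
move=> f0 xA; rewrite /part_fun big_bool /= !(gproj_id _ xA).
by case: j xA => _ /=; rewrite f0 raddf0 ?addr0 ?add0r.
Qed.

Lemma part_funD i f : {morph f : x y / x + y} ->
  {morph part_fun i f : x y / x + y}.
Proof.
move=> fD x y; rewrite /part_fun -big_split; apply: eq_bigr => j _ /=.
by rewrite raddfD fD raddfD.
Qed.

Lemma part_fun_parity i f : zmod_morphism f -> has_parity A B i (part_fun i f).
Proof.
move=> fB j x xA; have f0 : f 0 = 0 by rewrite -[0 in LHS](subrr 0) fB subrr.
by rewrite (part_funE _ f0 xA) gprojP.
Qed.

Lemma part_fun_sum f x : zmod_morphism f ->
  f x = part_fun false f x + part_fun true f x.
Proof.
move=> fB.
have fD := zmod_morphD fB.
rewrite /part_fun !big_bool /= [in LHS](gproj_sum A x) fD.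
rewrite {1}(gproj_sum B (f (gproj A false x))).
rewrite {1}(gproj_sum B (f (gproj A true x))).
by rewrite [RHS]addrC [RHS]addrACA [RHS]addrC [X in _ = X + _]addrC.
Qed.

Lemma has_parity_eq0 f : {morph f : x y / x + y} ->
  has_parity A B false f -> has_parity A B true f -> f =1 (fun=> 0).
Proof.
move=> fD f0 f1; apply: (homog_eq (A := A) fD) => [x y|j x xA].
  by rewrite addr0.
apply: (gpart_disj (A := B) (i := j) (j := ~~ j)); first by case: j {xA}.
  by have := f0 _ _ xA; rewrite addFb.
by have := f1 _ _ xA; rewrite addTb.
Qed.

End Parity.

Lemma gproj_ract (R : superRing) (M : rmod R) i k (r : R) (x : M) :
  r \in sr_grad R k ->
  gproj (rm_grad M) (i (+) k) ((r : R^c) *: x) = (r : R^c) *: gproj (rm_grad M) i x.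
Proof.
move=> rR; move: x; apply: (homog_eq (A := rm_grad M)) => [x y|x y|j x xM].
- by rewrite scalerDr raddfD.
- by rewrite raddfD scalerDr.
rewrite (gproj_id _ (rm_gradM xM rR)) (gproj_id _ xM).
by case: i j k {xM rR} => -[] [] /=; rewrite ?scaler0.
Qed.

(* The group of all R-linear maps between right modules; its homogeneous parts
   are the parity-preserving and the parity-reversing maps. *)
Section RightHom.
Variables (R : superRing) (M N : rmod R).

Definition rhom_pred (i : bool) : {pred {linear M -> N}} :=
  fun f => `[< has_parity (rm_grad M) (rm_grad N) i f >].

Lemma rhom_predB i : zmod_closed (rhom_pred i).
Proof.
split=> [|f g]; first by apply/asboolP => j x _ /=; exact: rpred0.
by move=> /asboolP fP /asboolP gP; apply/asboolP; exact: has_parityB.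
Qed.
HB.instance Definition _ i :=
  GRing.isZmodClosed.Build {linear M -> N} (rhom_pred i) (rhom_predB i).

Lemma rhom_part_linear i (f : {linear M -> N}) :
  linear (part_fun (rm_grad M) (rm_grad N) i f : M -> N).
Proof.
have fD : {morph f : x y / x + y} by exact: raddfD.
have f0 : f 0 = 0 by exact: raddf0.
have pD := part_funD (rm_grad M) (rm_grad N) i fD.
move=> r x y; rewrite pD; congr (_ + _).
move: r; apply: (homog_eq (A := sr_grad R)) => [r s|r s|k r rR].
- by rewrite scalerDl pD.
- by rewrite scalerDl.
move: x; apply: (homog_eq (A := rm_grad M)) => [x z|x z|j x xM].
- by rewrite scalerDr pD.
- by rewrite pD scalerDr.
rewrite (part_funE _ _ f0 (rm_gradM xM rR)) (part_funE _ _ f0 xM).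
by rewrite linearZ addbA gproj_ract.
Qed.

Definition rhom_part i (f : {linear M -> N}) : {linear M -> N} :=
  HB.pack (part_fun (rm_grad M) (rm_grad N) i f : M -> N)
    (GRing.isLinear.Build R^c M N *:%R _ (rhom_part_linear i f)).

Lemma rhom_direct (f : {linear M -> N}) : exists! p : {linear M -> N} * {linear M -> N},
  [/\ p.1 \in rhom_pred false, p.2 \in rhom_pred true & f = p.1 + p.2].
Proof.
move: f; apply: (grading_mk (A := fun i => rhom_pred i)) => f.
  move=> /asboolP f0 /asboolP f1; apply: linear_ext => x.
  exact: (has_parity_eq0 (raddfD f) f0 f1).
exists (rhom_part false f), (rhom_part true f); split.
- by apply/asboolP; apply: part_fun_parity; exact: raddfB.
- by apply/asboolP; apply: part_fun_parity; exact: raddfB.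
by apply: linear_ext => x; apply: part_fun_sum; exact: raddfB.
Qed.

Definition rHom : superAb := SuperAb (Grading rhom_direct).

End RightHom.

Lemma rhom_comp_parity (R : superRing) (L M N : rmod R) i j
    (f : rHom M N) (g : rHom L M) :
  f \in sa_grad (rHom M N) i -> g \in sa_grad (rHom L M) j ->
  (f \o g : rHom L N) \in sa_grad (rHom L N) (i (+) j).
Proof.
move=> /asboolP fP /asboolP gP; apply/asboolP => k x xL /=.
by rewrite -addbA; apply/fP/gP.
Qed.

Lemma rhom_id_even (R : superRing) (M : rmod R) :
  (idfun : rHom M M) \in sa_grad (rHom M M) false.
Proof. by apply/asboolP => j x. Qed.

Section RightEnd.
Variables (R : superRing) (M : rmod R).

Definition rend_car : Type := {linear M -> M}.
HB.instance Definition _ := GRing.Zmodule.on rend_car.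
Definition rend_mul (f g : rend_car) : rend_car := f \o g.
Definition rend_one : rend_car := idfun.

Lemma rend_mulA : associative rend_mul.
Proof. by move=> f g h; apply: linear_ext. Qed.
Lemma rend_mul1 : left_id rend_one rend_mul.
Proof. by move=> f; apply: linear_ext. Qed.
Lemma rend_mulr1 : right_id rend_one rend_mul.
Proof. by move=> f; apply: linear_ext. Qed.
Lemma rend_mulDl : left_distributive rend_mul +%R.
Proof. by move=> f g h; apply: linear_ext. Qed.
Lemma rend_mulDr : right_distributive rend_mul +%R.
Proof. by move=> f g h; apply: linear_ext => x; exact: raddfD. Qed.
HB.instance Definition _ := GRing.Zmodule_isPzRing.Build rend_car
  rend_mulA rend_mul1 rend_mulr1 rend_mulDl rend_mulDr.

Definition rEnd : superRing :=
  @SuperRing rend_car (sa_grad (rHom M M)) (@rhom_comp_parity R M M M).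
End RightEnd.

(* Left modules: a homogeneous f satisfies f (s x) = (-1)^(|s||f|) s (f x), and
   a general element is a sum of an even and an odd one. *)
Section LeftHom.
Variables (S : superRing) (M N : lmod S).

Definition lhom_homog (i : bool) (f : M -> N) : Prop :=
  [/\ zmod_morphism f, has_parity (lm_grad M) (lm_grad N) i f &
      forall j (s : S) x, s \in sr_grad S j -> f (s *: x) = ksgn j i (s *: f x)].

Definition lhom_pred : {pred M -> N} := fun f =>
  `[< exists f0 f1, [/\ lhom_homog false f0, lhom_homog true f1 & f = f0 + f1] >].

Lemma lhom_homogB i f g : lhom_homog i f -> lhom_homog i g -> lhom_homog i (f - g).
Proof.
move=> [fB fP fS] [gB gP gS]; split=> [x y||j s x sS].
- change (f (x - y) - g (x - y) = (f x - g x) - (f y - g y)).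
  by rewrite fB gB !opprD !opprK addrACA.
- exact: has_parityB.
- change (f (s *: x) - g (s *: x) = ksgn j i (s *: (f x - g x))).
  by rewrite (fS _ _ _ sS) (gS _ _ _ sS) scalerBr /ksgn; case: ifP; rewrite ?opprD.
Qed.

Lemma lhom_homog0 i : lhom_homog i 0.
Proof.
split=> [x y||j s x _]; first by rewrite subr0.
- exact: has_parity0.
- by change (0 = ksgn j i (s *: (0 : N))); rewrite scaler0 /ksgn oppr0 if_same.
Qed.

Lemma lhom_predB : zmod_closed lhom_pred.
Proof.
split=> [|f g].
  by apply/asboolP; exists 0, 0; split; [exact: lhom_homog0..|rewrite addr0].
move=> /asboolP[f0 [f1 [f0P f1P ->]]] /asboolP[g0 [g1 [g0P g1P ->]]].
apply/asboolP; exists (f0 - g0), (f1 - g1); split; try exact: lhom_homogB.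
by rewrite opprD addrACA.
Qed.
HB.instance Definition _ := GRing.isZmodClosed.Build (M -> N) lhom_pred lhom_predB.

Record lhom : Type := LHomMk { lhom_fun :> M -> N; lhom_mem : lhom_fun \in lhom_pred }.
HB.instance Definition _ := [isSub for lhom_fun].
HB.instance Definition _ := gen_eqMixin lhom.
HB.instance Definition _ := gen_choiceMixin lhom.
HB.instance Definition _ := [SubChoice_isSubZmodule of lhom by <:].

Lemma lhom_ext (f g : lhom) : f =1 g -> f = g.
Proof. by move=> /funext fg; apply: val_inj. Qed.

Lemma lhom_addE (f g : lhom) x : (f + g) x = f x + g x.
Proof. by []. Qed.

Lemma lhom_homogW i f : lhom_homog i f -> f \in lhom_pred.
Proof.
move=> fP; apply/asboolP; case: i fP => fP.
  by exists 0, f; split=> //; [exact: lhom_homog0|rewrite add0r].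
by exists f, 0; split=> //; [exact: lhom_homog0|rewrite addr0].
Qed.

Definition lhom_part (i : bool) : {pred lhom} := fun f => `[< lhom_homog i f >].

Lemma lhom_partB i : zmod_closed (lhom_part i).
Proof.
split=> [|f g]; first by apply/asboolP; exact: lhom_homog0.
by move=> /asboolP fP /asboolP gP; apply/asboolP; exact: lhom_homogB.
Qed.
HB.instance Definition _ i :=
  GRing.isZmodClosed.Build lhom (lhom_part i) (lhom_partB i).

Lemma lhom_direct (f : lhom) : exists! p : lhom * lhom,
  [/\ p.1 \in lhom_part false, p.2 \in lhom_part true & f = p.1 + p.2].
Proof.
move: f; apply: (grading_mk (A := fun i => lhom_part i)) => f.
  move=> /asboolP[fB f0 _] /asboolP[_ f1 _]; apply: lhom_ext => x.
  exact: (has_parity_eq0 (zmod_morphD fB) f0 f1).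
have /asboolP[f0 [f1 [f0P f1P fE]]] := lhom_mem f.
exists (LHomMk (lhom_homogW f0P)), (LHomMk (lhom_homogW f1P)).
by split; [exact/asboolP..|apply: val_inj].
Qed.

Definition lHom : superAb := SuperAb (Grading lhom_direct).

End LeftHom.

Section LeftEnd.
Variables (S : superRing) (M : lmod S).
Notation D := (lm_grad M).

Lemma lhom_comp_homog i j (f g : M -> M) : lhom_homog i f -> lhom_homog j g ->
  lhom_homog (i (+) j) (f \o g).
Proof.
move=> [fB fP fS] [gB gP gS]; split=> [x y|k x xM|k s x sS] /=.
- by rewrite gB fB.
- by rewrite -addbA; apply/fP/gP.
- rewrite (gS _ _ _ sS) (ksgn_add _ _ _ fB) (fS _ _ _ sS) /ksgn.
  by case: i j k {fP fS gP gS sS} => -[] [] /=; rewrite ?opprK.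
Qed.

Lemma lhom_id_homog : lhom_homog false (@idfun M).
Proof. by split=> // k s x _; rewrite /ksgn andbF. Qed.

Lemma lhom_comp_mem (f g : lhom M M) : f \o g \in @lhom_pred S M M.
Proof.
have /asboolP[f0 [f1 [f0P f1P ->]]] := lhom_mem f.
have /asboolP[g0 [g1 [g0P g1P ->]]] := lhom_mem g.
have -> : (f0 + f1) \o (g0 + g1) =
    ((f0 \o g0) + (f0 \o g1)) + ((f1 \o g0) + (f1 \o g1)) :> (M -> M).
  apply/funext => x /=.
  change (f0 (g0 x + g1 x) + f1 (g0 x + g1 x) =
    (f0 (g0 x) + f0 (g1 x)) + (f1 (g0 x) + f1 (g1 x))).
  by case: f0P f1P => [f0B _ _] [f1B _ _]; rewrite (zmod_morphD f0B) (zmod_morphD f1B).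
by rewrite !rpredD //;
  [exact: lhom_homogW (lhom_comp_homog f0P g0P)
  |exact: lhom_homogW (lhom_comp_homog f0P g1P)
  |exact: lhom_homogW (lhom_comp_homog f1P g0P)
  |exact: lhom_homogW (lhom_comp_homog f1P g1P)].
Qed.

Lemma lhom_additive (f : lhom M M) : {morph f : x y / x + y}.
Proof.
have /asboolP[f0 [f1 [[f0B _ _] [f1B _ _] ->]]] := lhom_mem f => x y.
change (f0 (x + y) + f1 (x + y) = (f0 x + f1 x) + (f0 y + f1 y)).
by rewrite (zmod_morphD f0B) (zmod_morphD f1B) addrACA.
Qed.

Definition lend_car : Type := lhom M M.
HB.instance Definition _ := GRing.Zmodule.on lend_car.
Definition lend_mul (f g : lend_car) : lend_car := LHomMk (lhom_comp_mem f g).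
Definition lend_one : lend_car := LHomMk (lhom_homogW lhom_id_homog).

Lemma lend_mulA : associative lend_mul.
Proof. by move=> f g h; apply: lhom_ext. Qed.
Lemma lend_mul1r : left_id lend_one lend_mul.
Proof. by move=> f; apply: lhom_ext. Qed.
Lemma lend_mulr1 : right_id lend_one lend_mul.
Proof. by move=> f; apply: lhom_ext. Qed.
Lemma lend_mulDl : left_distributive lend_mul +%R.
Proof. by move=> f g h; apply: lhom_ext. Qed.
Lemma lend_mulDr : right_distributive lend_mul +%R.
Proof. by move=> f g h; apply: lhom_ext => x; exact: lhom_additive. Qed.
HB.instance Definition _ := GRing.Zmodule_isPzRing.Build lend_car
  lend_mulA lend_mul1r lend_mulr1 lend_mulDl lend_mulDr.

Lemma lend_gradM i j (f g : lend_car) : f \in sa_grad (lHom M M) i ->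
  g \in sa_grad (lHom M M) j -> f * g \in sa_grad (lHom M M) (i (+) j).
Proof.
move=> /asboolP fP /asboolP gP; apply/asboolP; exact: lhom_comp_homog.
Qed.

Definition lEnd : superRing := @SuperRing lend_car (sa_grad (lHom M M)) lend_gradM.
End LeftEnd.

Section FaithfullyBalanced.
Variables (A B : superRing) (C : bimod A B).
Let GB := sr_grad B.
Let GC := rm_grad C.

Lemma left_mul_linear (a : A) : linear (lact (b := C) a : C -> C).
Proof. by move=> r x y; rewrite lactDr lact_ract. Qed.

(* a |-> (c |-> a c) *)
Definition left_mul (a : A) : rEnd C :=
  (HB.pack (lact (b := C) a : C -> C)
     (GRing.isLinear.Build B^c C C *:%R _ (left_mul_linear a)) : {linear C -> C}).

(* b |-> (c |-> (-1)^(|b||c|) c b), extended biadditively. *)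
Definition right_mul_fun (b : B) (c : bm_left C) : bm_left C :=
  \sum_(i : bool) \sum_(j : bool)
    ksgn i j ((gproj GB i b : B^c) *: (gproj GC j c : C)).

Lemma right_mul_funD b : {morph right_mul_fun b : x y / x + y}.
Proof.
move=> x y; rewrite /right_mul_fun -big_split; apply: eq_bigr => i _ /=.
rewrite -big_split; apply: eq_bigr => j _ /=.
by rewrite raddfD scalerDr ksgnD.
Qed.

Lemma right_mul_funDl c : {morph right_mul_fun^~ c : x y / x + y}.
Proof.
move=> x y; rewrite /right_mul_fun -big_split; apply: eq_bigr => i _ /=.
rewrite -big_split; apply: eq_bigr => j _ /=.
by rewrite raddfD scalerDl ksgnD.
Qed.

Lemma right_mul_funE i j (b : B) (c : C) : b \in GB i -> c \in GC j ->
  right_mul_fun b c = ksgn i j ((b : B^c) *: c).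
Proof.
move=> bB cC; rewrite /right_mul_fun !big_bool /= !(gproj_id _ bB) !(gproj_id _ cC).
by case: i j {bB cC} => -[] /=; rewrite /ksgn /= ?(scaler0, scale0r, oppr0, addr0, add0r).
Qed.

Lemma right_mul_homog i b : b \in GB i -> lhom_homog i (right_mul_fun b).
Proof.
move=> bB; have rD := right_mul_funD b; split.
- exact: morphDB.
- move=> j c cC; rewrite (right_mul_funE bB cC) mem_ksgn // addbC.
  exact: rm_gradM.
- move=> j a c aA; move: c; apply: (homog_eq (A := GC)) => [x y|x y|k c cC].
  + by rewrite scalerDr rD.
  + by rewrite rD scalerDr ksgnD.
  have acC : (a *: (c : bm_left C)) \in GC (j (+) k) := lact_grad aA cC.
  rewrite (right_mul_funE bB acC) (right_mul_funE bB cC).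
  have -> : (b : B^c) *: (a *: (c : bm_left C) : C) = lact a ((b : B^c) *: c).
    by rewrite lact_ract.
  rewrite -[a *: _]/(lact a _) /ksgn.
  have lN : {morph lact (b := C) a : x / - x}.
    by move=> x; apply: (addrI (lact a x)); rewrite -lactDr !subrr (morphD0 (lactDr a)).
  by case: i j k {bB cC aA acC} => -[] [] /=; rewrite ?lN ?opprK.
Qed.

Lemma right_mul_mem b : right_mul_fun b \in @lhom_pred A (bm_left C) (bm_left C).
Proof.
apply/asboolP; exists (right_mul_fun (gproj GB false b)),
  (right_mul_fun (gproj GB true b)).
split; try by apply: right_mul_homog; exact: gprojP.
by apply/funext => c; rewrite {1}(gproj_sum GB b) right_mul_funDl.
Qed.

Definition right_mul (b : B) : sopp (lEnd (bm_left C)) := LHomMk (right_mul_mem b).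

Definition faithfully_balanced : Prop :=
  super_ring_iso left_mul /\ super_ring_iso right_mul.

End FaithfullyBalanced.

(* The subgroup generated by X. *)
Section Span.
Variables (G : zmodType) (X : G -> Prop).

Definition span : {pred G} := fun x =>
  `[< forall B : zmodClosed G, (forall y, X y -> y \in B) -> x \in B >].

Lemma span_zmod_closed : zmod_closed span.
Proof.
split=> [|x y /asboolP xS /asboolP yS]; apply/asboolP => B XB; first exact: rpred0.
by apply: rpredB; [apply: xS|apply: yS].
Qed.
HB.instance Definition _ := GRing.isZmodClosed.Build G span span_zmod_closed.

Lemma mem_span x : X x -> x \in span.
Proof. by move=> Xx; apply/asboolP => B; apply. Qed.

Lemma span_ind (Q : G -> Prop) : Q 0 -> (forall x y, Q x -> Q y -> Q (x - y)) ->
  (forall x, X x -> Q x) -> forall x, x \in span -> Q x.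
Proof.
move=> Q0 QB QX x /asboolP xS.
have QP : zmod_closed (fun x => `[< Q x >] : bool).
  by split=> [|y z /asboolP Qy /asboolP Qz]; apply/asboolP; [|exact: QB].
pose B : zmodClosed G := HB.pack (fun x => `[< Q x >])
  (GRing.isZmodClosed.Build G (fun x => `[< Q x >]) QP).
by have /asboolP : x \in B by apply: xS => y /QX Qy; apply/asboolP.
Qed.

End Span.

(* The tensor product over S: the free abelian group on M * N modulo the
   subgroup generated by the bilinearity and balancing relations. *)
Section Tensor.
Variables (S : superRing) (M : rmod S) (N : lmod S).

Notation free := {freeg (M * N)%type}.

Inductive tens_rel : free -> Prop :=
| TensDl m m' n : tens_rel (<< (m + m', n) >> - << (m, n) >> - << (m', n) >>)
| TensDr m n n' : tens_rel (<< (m, n + n') >> - << (m, n) >> - << (m, n') >>)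
| TensM m (s : S) n : tens_rel (<< ((s : S^c) *: m, n) >> - << (m, s *: n) >>).

Definition tens : Type := Quotient.quot (span tens_rel : zmodClosed free).
HB.instance Definition _ := GRing.Zmodule.on tens.

Definition tpi : free -> tens := \pi_(Quotient.quot (span tens_rel : zmodClosed free)).
Lemma tpiB : zmod_morphism tpi.
Proof. by move=> x y; exact: raddfB. Qed.
HB.instance Definition _ := GRing.isZmodMorphism.Build free tens tpi tpiB.

Definition tpure (m : M) (n : N) : tens := tpi << (m, n) >>.

Lemma tpi_rel (x : free) : tens_rel x -> tpi x = 0.
Proof.
move=> xR; rewrite -(raddf0 tpi); apply/eqP.
rewrite /tpi -(Quotient.idealrBE (span tens_rel : zmodClosed free)) subr0.
exact: mem_span.
Qed.

Lemma tpureDl n : {morph tpure^~ n : m m' / m + m'}.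
Proof.
move=> m m'; apply/eqP; rewrite -subr_eq0 opprD addrA -!raddfB.
apply/eqP/tpi_rel; exact: TensDl.
Qed.

Lemma tpureDr m : {morph tpure m : n n' / n + n'}.
Proof.
move=> n n'; apply/eqP; rewrite -subr_eq0 opprD addrA -!raddfB.
apply/eqP/tpi_rel; exact: TensDr.
Qed.

Lemma tpureM m (s : S) n : tpure ((s : S^c) *: m) n = tpure m (s *: n).
Proof.
apply/eqP; rewrite -subr_eq0 -raddfB.
apply/eqP/tpi_rel; exact: TensM.
Qed.

Lemma tens_ind (Q : tens -> Prop) : Q 0 -> (forall x y, Q x -> Q y -> Q (x - y)) ->
  (forall m n, Q (tpure m n)) -> forall t, Q t.
Proof.
move=> Q0 QB Qp t.
have QP : zmod_closed (fun x => `[< Q x >] : bool).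
  by split=> [|y z /asboolP Qy /asboolP Qz]; apply/asboolP; [|exact: QB].
pose B : zmodClosed tens := HB.pack (fun x => `[< Q x >])
  (GRing.isZmodClosed.Build tens (fun x => `[< Q x >]) QP).
suff /asboolP : t \in B by [].
have -> : t = tpi (repr t) by rewrite /tpi reprK.
rewrite -(freeg_sumE (repr t)) raddf_sum; apply: rpred_sum => -[m n] _.
rewrite -[coeff _ _]intz -freeg_mulz raddfMz rpredMz //.
by apply/asboolP; exact: Qp.
Qed.

Lemma tens_eq (A : zmodType) (f g : tens -> A) :
  {morph f : x y / x + y} -> {morph g : x y / x + y} ->
  (forall m n, f (tpure m n) = g (tpure m n)) -> f =1 g.
Proof.
move=> fD gD fg.
elim/tens_ind => [|x y fx fy|//]; first by rewrite (morphD0 fD) (morphD0 gD).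
by rewrite (morphDB fD) (morphDB gD) fx fy.
Qed.

Definition balanced (A : zmodType) (f : M -> N -> A) : Prop :=
  [/\ forall n, {morph f^~ n : m m' / m + m'},
      forall m, {morph f m : n n' / n + n'} &
      forall m (s : S) n, f ((s : S^c) *: m) n = f m (s *: n)].

Section Lift.
Variables (A : zmodType) (f : M -> N -> A).

Definition tlift (t : tens) : A :=
  fglift (fun p : M * N => f p.1 p.2 : zmodule A) (repr t).

Hypothesis fP : balanced f.

Let flift (x : free) : zmodule A := fglift (fun p : M * N => f p.1 p.2 : zmodule A) x.
Let fliftB : zmod_morphism flift := lift_is_additive _.
Let fliftU p : flift << p >> = f p.1 p.2.
Proof. by rewrite /flift liftU scale1r. Qed.

Lemma tlift_pi x : tlift (tpi x) = flift x.
Proof.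
apply/eqP; rewrite -subr_eq0 -[_ - _]fliftB; apply/eqP.
have : repr (tpi x) - x \in span tens_rel.
  by rewrite Quotient.idealrBE /tpi reprK.
move: (_ - _); apply: span_ind.
- by rewrite -[0](subrr 0) fliftB subrr.
- by move=> y z y0 z0; rewrite fliftB y0 z0 subr0.
case: fP => fDl fDr fM.
move=> _ [m m' n|m n n'|m s n]; rewrite !fliftB !fliftU /=.
- by rewrite fDl [f m n + _]addrC addrK subrr.
- by rewrite fDr [f m n + _]addrC addrK subrr.
- by rewrite fM subrr.
Qed.

Lemma tliftE m n : tlift (tpure m n) = f m n.
Proof. by rewrite tlift_pi fliftU. Qed.

Lemma tliftB : zmod_morphism tlift.
Proof.
move=> t u; have -> : t = tpi (repr t) by rewrite /tpi reprK.
have -> : u = tpi (repr u) by rewrite /tpi reprK.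
by rewrite -raddfB !tlift_pi fliftB.
Qed.

Lemma tliftD : {morph tlift : t u / t + u}.
Proof. exact: (zmod_morphD tliftB). Qed.
End Lift.

(* (M (x) N)_k is generated by the x (x) y with |x| + |y| = k. *)
Inductive tens_homog (k : bool) : tens -> Prop :=
| TensHomog i j m n : m \in rm_grad M i -> n \in lm_grad N j -> i (+) j = k ->
    tens_homog k (tpure m n).

Definition tens_part (k : bool) : zmodClosed tens := span (tens_homog k).

Lemma mem_tens_part i j m n : m \in rm_grad M i -> n \in lm_grad N j ->
  tpure m n \in tens_part (i (+) j).
Proof. by move=> mM nN; apply: mem_span; exact: TensHomog mM nN _. Qed.

Definition tproj_fun k (m : M) (n : N) : tens :=
  \sum_(i : bool) tpure (gproj (rm_grad M) i m) (gproj (lm_grad N) (i (+) k) n).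

Lemma tproj_funDl k n : {morph tproj_fun k ^~ n : m m' / m + m'}.
Proof.
move=> m m'; rewrite /tproj_fun -big_split; apply: eq_bigr => i _ /=.
by rewrite raddfD tpureDl.
Qed.

Lemma tproj_funDr k m : {morph tproj_fun k m : n n' / n + n'}.
Proof.
move=> n n'; rewrite /tproj_fun -big_split; apply: eq_bigr => i _ /=.
by rewrite raddfD tpureDr.
Qed.

Lemma tproj_funE k i j m n : m \in rm_grad M i -> n \in lm_grad N j ->
  tproj_fun k m n = if k == i (+) j then tpure m n else 0.
Proof.
have p0l n' : tpure 0 n' = 0 := morphD0 (tpureDl n').
have p0r m' : tpure m' 0 = 0 := morphD0 (tpureDr m').
move=> mM nN; rewrite /tproj_fun big_bool /= !(gproj_id _ mM) !(gproj_id _ nN).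
by case: i j k {mM nN} => -[] [] /=; rewrite ?(p0l, p0r, addr0, add0r).
Qed.

Lemma tproj_balanced k : balanced (tproj_fun k).
Proof.
split; [exact: tproj_funDl | exact: tproj_funDr |] => m s n.
move: s; apply: (homog_eq (A := sr_grad S)) => [s t|s t|l s sS].
- by rewrite scalerDl tproj_funDl.
- by rewrite scalerDl tproj_funDr.
move: m; apply: (homog_eq (A := rm_grad M)) => [m m'|m m'|i m mM].
- by rewrite scalerDr tproj_funDl.
- by rewrite tproj_funDl.
move: n; apply: (homog_eq (A := lm_grad N)) => [n n'|n n'|j n nN].
- by rewrite tproj_funDr.
- by rewrite scalerDr tproj_funDr.
rewrite (tproj_funE k (rm_gradM mM sS) nN) (tproj_funE k mM (lm_gradM sS nN)).
by rewrite addbA tpureM.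
Qed.

Lemma tproj_id k l t : t \in tens_part l ->
  tlift (tproj_fun k) t = if k == l then t else 0.
Proof.
have pB := tliftB (tproj_balanced k).
move: t; apply: span_ind => [|x y xE yE|_ [i j m n mM nN <-]].
- by rewrite (morphD0 (zmod_morphD pB)) if_same.
- by rewrite pB xE yE; case: ifP => //; rewrite subr0.
- by rewrite (tliftE (tproj_balanced k)) (tproj_funE k mM nN).
Qed.

Lemma tens_direct (t : tens) : exists! p : tens * tens,
  [/\ p.1 \in tens_part false, p.2 \in tens_part true & t = p.1 + p.2].
Proof.
move: t; apply: grading_mk => [t t0 t1|].
  by have := tproj_id false t0; rewrite (tproj_id false t1).
elim/tens_ind => [|x y [a [b [aP bP ->]]] [c [d [cP dP ->]]]|m n].
- by exists 0, 0; rewrite !rpred0 addr0.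
- by exists (a - c), (b - d); rewrite !rpredB // opprD addrACA.
have gM i := gprojP (rm_grad M) i m; have gN i := gprojP (lm_grad N) i n.
exists (tpure (gproj (rm_grad M) false m) (gproj (lm_grad N) false n) +
        tpure (gproj (rm_grad M) true m) (gproj (lm_grad N) true n)),
  (tpure (gproj (rm_grad M) false m) (gproj (lm_grad N) true n) +
   tpure (gproj (rm_grad M) true m) (gproj (lm_grad N) false n)); split.
- by rewrite rpredD //; [exact: mem_tens_part (gM false) (gN false)
                        |exact: mem_tens_part (gM true) (gN true)].
- by rewrite rpredD //; [exact: mem_tens_part (gM false) (gN true)
                        |exact: mem_tens_part (gM true) (gN false)].
rewrite addrACA [X in _ = _ + X]addrC -!tpureDr -!gproj_sum -tpureDl.
by rewrite -gproj_sum.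
Qed.

Definition tens_grad : grading tens := Grading tens_direct.

End Tensor.

Section TensorModule.
Variables (S R : superRing) (M : rmod S) (P : bimod S R).
Local Notation MP := (tens M (bm_left P)).

Definition tens_ract_fun (r : R^c) (m : M) (p : bm_left P) : MP :=
  tpure m (r *: (p : P) : bm_left P).

Lemma tens_ract_balanced r : balanced (tens_ract_fun r).
Proof.
rewrite /tens_ract_fun; split=> [p m m'|m p p'|m s p].
- by rewrite tpureDl.
- by rewrite [X in tpure m X](scalerDr r (p : P) (p' : P)); exact: tpureDr.
- by rewrite tpureM -[s *: _]/(lact s _) lact_ract.
Qed.

Definition tens_ract (r : R^c) : MP -> MP := tlift (tens_ract_fun r).

Lemma tens_ractE r m p : tens_ract r (tpure m p) = tpure m (r *: (p : P) : bm_left P).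
Proof. exact: tliftE (tens_ract_balanced r) m p. Qed.

Lemma tens_ractDr r : {morph tens_ract r : t u / t + u}.
Proof. exact: tliftD (tens_ract_balanced r). Qed.

Lemma tens_ractDl t : {morph tens_ract^~ t : r r' / r + r'}.
Proof.
move=> r r'; move: t; apply: tens_eq => [t u|t u|m p].
- by rewrite tens_ractDr.
- by rewrite !tens_ractDr addrACA.
- by rewrite !tens_ractE scalerDl tpureDr.
Qed.

Lemma tens_ractA r r' t : tens_ract r (tens_ract r' t) = tens_ract (r * r') t.
Proof.
move: t; apply: tens_eq => [t u|t u|m p]; rewrite ?tens_ractDr //.
by rewrite !tens_ractE scalerA.
Qed.

Lemma tens_ract1 : left_id 1 tens_ract.
Proof.
by apply: tens_eq => [t u|t u|m p] //; rewrite ?tens_ractDr // tens_ractE scale1r.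
Qed.

Definition tens_car : Type := MP.
HB.instance Definition _ := GRing.Zmodule.on tens_car.
HB.instance Definition _ := GRing.Zmodule_isLmodule.Build R^c tens_car
  tens_ractA tens_ract1 tens_ractDr tens_ractDl.

Lemma tens_gradM i j (t : tens_car) (r : R) :
  t \in tens_grad M (bm_left P) i -> r \in sr_grad R j ->
  (r : R^c) *: t \in tens_grad M (bm_left P) (i (+) j).
Proof.
move=> tM rR; move: t tM; apply: span_ind => [|t u tP uP|_ [a b m p mM pP <-]].
- by rewrite scaler0 rpred0.
- by rewrite scalerBr rpredB.
- rewrite -[_ *: _]/(tens_ract r _) tens_ractE -addbA.
  by apply: mem_tens_part => //; exact: rm_gradM.
Qed.

Definition tensor : rmod R := @Rmod R tens_car (tens_grad M (bm_left P)) tens_gradM.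

Lemma tensor_ractE (r : R^c) m (p : bm_left P) :
  r *: (tpure m p : tensor) = tpure m (r *: (p : P) : bm_left P).
Proof. exact: tens_ractE. Qed.
End TensorModule.

Section TensorMap.
Variables (S R : superRing) (M N : rmod S) (P : bimod S R) (f : {linear M -> N}).

Definition tmap_fun (m : M) (p : bm_left P) : tensor N P := tpure (f m) p.

Lemma tmap_balanced : balanced tmap_fun.
Proof.
rewrite /tmap_fun; split=> [p m m'|m p p'|m s p].
- by rewrite raddfD; exact: tpureDl.
- exact: tpureDr.
- by rewrite linearZ; exact: tpureM.
Qed.

Lemma tmap_linear : linear (tlift tmap_fun : tensor M P -> tensor N P).
Proof.
move=> r t u; rewrite (tliftD tmap_balanced); congr (_ + _).
move: t; apply: tens_eq => [t v|t v|m p].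
- by rewrite [X in tlift _ X](scalerDr r (t : tensor M P) v); exact: (tliftD tmap_balanced).
- by rewrite (tliftD tmap_balanced); exact: scalerDr.
rewrite (tliftE tmap_balanced) /tmap_fun tensor_ractE [LHS](tliftE tmap_balanced).
by rewrite tensor_ractE.
Qed.

(* f (x) P *)
Definition tmap : {linear tensor M P -> tensor N P} :=
  HB.pack (tlift tmap_fun : tensor M P -> tensor N P)
    (GRing.isLinear.Build R^c (tensor M P) (tensor N P) *:%R _ tmap_linear).

Lemma tmapE m p : tmap (tpure m p) = tpure (f m) p.
Proof. exact: tliftE tmap_balanced m p. Qed.
End TensorMap.

Lemma tmap_eq (S R : superRing) (M : rmod S) (N : rmod R) (P : bimod S R)
    (f g : {linear tensor M P -> N}) :
  (forall m p, f (tpure m p) = g (tpure m p)) -> f = g.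
Proof.
by move=> fg; apply: linear_ext; apply: tens_eq => // x y; exact: raddfD.
Qed.

Lemma tmap_parity (S R : superRing) (M N : rmod S) (P : bimod S R) i
    (f : rHom M N) : f \in sa_grad (rHom M N) i ->
  (tmap P f : rHom (tensor M P) (tensor N P))
    \in sa_grad (rHom (tensor M P) (tensor N P)) i.
Proof.
move=> /asboolP fP; apply/asboolP => j.
apply: span_ind => [|t u tP uP|_ [a b m p mM pP <-]].
- by rewrite raddf0 rpred0.
- by rewrite raddfB rpredB.
- by rewrite tmapE addbA; apply: mem_tens_part => //; exact: fP.
Qed.

Section TensorBimodule.
Variables (Q S R : superRing) (M : bimod Q S) (P : bimod S R).

Definition tens_lact (q : Q) : tensor M P -> tensor M P := tmap P (left_mul M q).

Lemma tens_lactE q m p : tens_lact q (tpure m p) = tpure (lact q m) p.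
Proof. exact: tmapE. Qed.

Lemma tens_lactDr q : {morph tens_lact q : x y / x + y}.
Proof. by move=> x y; exact: raddfD. Qed.

Lemma tens_lactA q q' x : tens_lact q (tens_lact q' x) = tens_lact (q * q') x.
Proof.
move: x; apply: tens_eq => [x y|x y|m p]; rewrite ?tens_lactDr //.
by rewrite !tens_lactE lactA.
Qed.

Lemma tens_lact1 x : tens_lact 1 x = x.
Proof.
by move: x; apply: tens_eq => [x y|x y|m p] //; rewrite ?tens_lactDr // tens_lactE lact1.
Qed.

Lemma tens_lactDl x : {morph tens_lact^~ x : q q' / q + q'}.
Proof.
move=> q q'; move: x; apply: tens_eq => [x y|x y|m p].
- by rewrite tens_lactDr.
- by rewrite !tens_lactDr addrACA.
- by rewrite !tens_lactE lactDl tpureDl.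
Qed.

Lemma tens_lact_ract q x (r : R) :
  tens_lact q ((r : R^c) *: x) = (r : R^c) *: tens_lact q x.
Proof. exact: linearZ_LR. Qed.

Lemma left_mul_parity i (q : Q) : q \in sr_grad Q i ->
  left_mul M q \in sr_grad (rEnd M) i.
Proof. by move=> qQ; apply/asboolP => j x xM; exact: lact_grad. Qed.

Lemma tens_lact_grad i j q x : q \in sr_grad Q i -> x \in rm_grad (tensor M P) j ->
  tens_lact q x \in rm_grad (tensor M P) (i (+) j).
Proof. by move=> /left_mul_parity /(tmap_parity P) /asboolP; apply. Qed.

Definition tensor_bimod : bimod Q R :=
  Bimod tens_lactA tens_lact1 tens_lactDr tens_lactDl tens_lact_ract tens_lact_grad.
End TensorBimodule.

Record category := Category {
  cat_ob :> Type;
  cat_hom : cat_ob -> cat_ob -> Type;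
  cat_id : forall X, cat_hom X X;
  cat_comp : forall X Y Z, cat_hom Y Z -> cat_hom X Y -> cat_hom X Z;
  cat_compA : forall W X Y Z (h : cat_hom Y Z) (g : cat_hom X Y) (f : cat_hom W X),
    cat_comp h (cat_comp g f) = cat_comp (cat_comp h g) f;
  cat_comp1f : forall X Y (f : cat_hom X Y), cat_comp (cat_id Y) f = f;
  cat_compf1 : forall X Y (f : cat_hom X Y), cat_comp f (cat_id X) = f }.

Definition cat_iso (C : category) (X Y : C) (f : cat_hom X Y) : Prop :=
  exists g : cat_hom Y X,
    cat_comp g f = cat_id X /\ cat_comp f g = cat_id Y.

Record functor (C D : category) := Functor {
  fun_ob :> C -> D;
  fun_hom : forall X Y, cat_hom X Y -> cat_hom (fun_ob X) (fun_ob Y);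
  fun_id : forall X, fun_hom (cat_id X) = cat_id (fun_ob X);
  fun_comp : forall X Y Z (g : cat_hom Y Z) (f : cat_hom X Y),
    fun_hom (cat_comp g f) = cat_comp (fun_hom g) (fun_hom f) }.

Definition nat_iso (C D : category) (F G : functor C D) : Prop :=
  exists eta : forall X, cat_hom (F X) (G X),
    (forall X, cat_iso (eta X)) /\
    (forall X Y (f : cat_hom X Y),
      cat_comp (eta Y) (fun_hom F f) = cat_comp (fun_hom G f) (eta X)).

Definition functor_id (C : category) : functor C C :=
  @Functor C C id (fun X Y f => f) (fun X => erefl) (fun X Y Z g f => erefl).

Section FunctorComp.
Variables (C D E : category) (G : functor D E) (F : functor C D).
Let comp_hom X Y (f : cat_hom X Y) := fun_hom G (fun_hom F f).
Lemma functor_comp_id X : comp_hom (cat_id X) = cat_id (G (F X)).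
Proof. by rewrite /comp_hom !fun_id. Qed.
Lemma functor_comp_comp X Y Z (g : cat_hom Y Z) (f : cat_hom X Y) :
  comp_hom (cat_comp g f) = cat_comp (comp_hom g) (comp_hom f).
Proof. by rewrite /comp_hom !fun_comp. Qed.
Definition functor_comp : functor C E := Functor functor_comp_id functor_comp_comp.
End FunctorComp.

Definition is_equivalence (C D : category) (F : functor C D) : Prop :=
  exists G : functor D C,
    nat_iso (functor_comp G F) (functor_id C) /\
    nat_iso (functor_comp F G) (functor_id D).

(* Categories enriched in Z/2-graded abelian groups. *)
Record supercat := Supercat {
  sc_ob :> Type;
  sc_hom : sc_ob -> sc_ob -> superAb;
  sc_id : forall X, sc_hom X X;
  sc_comp : forall X Y Z, sc_hom Y Z -> sc_hom X Y -> sc_hom X Z;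
  sc_id_even : forall X, sc_id X \in sa_grad (sc_hom X X) false;
  sc_comp_grad : forall X Y Z i j (g : sc_hom Y Z) (f : sc_hom X Y),
    g \in sa_grad (sc_hom Y Z) i -> f \in sa_grad (sc_hom X Y) j ->
    sc_comp g f \in sa_grad (sc_hom X Z) (i (+) j);
  sc_compDl : forall X Y Z (f : sc_hom X Y),
    {morph (fun g : sc_hom Y Z => sc_comp g f) : g h / g + h};
  sc_compDr : forall X Y Z (g : sc_hom Y Z),
    {morph (fun f : sc_hom X Y => sc_comp g f) : f h / f + h};
  sc_compA : forall W X Y Z (h : sc_hom Y Z) (g : sc_hom X Y) (f : sc_hom W X),
    sc_comp h (sc_comp g f) = sc_comp (sc_comp h g) f;
  sc_comp1f : forall X Y (f : sc_hom X Y), sc_comp (sc_id Y) f = f;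
  sc_compf1 : forall X Y (f : sc_hom X Y), sc_comp f (sc_id X) = f }.

(* The underlying category, with the even morphisms only. *)
Section EvenCat.
Variable C : supercat.
Implicit Types X Y Z : C.
Definition even_hom X Y : Type := evenpart (sc_hom X Y).
Definition even_id X : even_hom X X := exist _ (sc_id X) (sc_id_even X).
Definition even_comp X Y Z (g : even_hom Y Z) (f : even_hom X Y) : even_hom X Z :=
  exist _ (sc_comp (val g) (val f)) (sc_comp_grad (valP g) (valP f)).
Lemma even_compA W X Y Z (h : even_hom Y Z) (g : even_hom X Y) (f : even_hom W X) :
  even_comp h (even_comp g f) = even_comp (even_comp h g) f.
Proof. by apply: val_inj; exact: sc_compA. Qed.
Lemma even_comp1f X Y (f : even_hom X Y) : even_comp (even_id Y) f = f.
Proof. by apply: val_inj; exact: sc_comp1f. Qed.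
Lemma even_compf1 X Y (f : even_hom X Y) : even_comp f (even_id X) = f.
Proof. by apply: val_inj; exact: sc_compf1. Qed.
Definition even_cat : category := Category even_compA even_comp1f even_compf1.
End EvenCat.

(* Module categories must be compared through functors acting on odd morphisms
   too: tensoring with a bimodule does, but an arbitrary functor on the even
   morphisms need not extend.  Over the purely even ring of complex numbers,
   V |-> V_0 (+) conj(V_1) is an equivalence on even morphisms that is not given
   by a bimodule. *)
Record superfunctor (C D : supercat) := Superfunctor {
  sf_ob :> C -> D;
  sf_hom : forall X Y, sc_hom X Y -> sc_hom (sf_ob X) (sf_ob Y);
  sf_homD : forall X Y, {morph @sf_hom X Y : f g / f + g};
  sf_hom_grad : forall X Y i (f : sc_hom X Y), f \in sa_grad (sc_hom X Y) i ->
    sf_hom f \in sa_grad (sc_hom (sf_ob X) (sf_ob Y)) i;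
  sf_id : forall X, sf_hom (sc_id X) = sc_id (sf_ob X);
  sf_comp : forall X Y Z (g : sc_hom Y Z) (f : sc_hom X Y),
    sf_hom (sc_comp g f) = sc_comp (sf_hom g) (sf_hom f) }.

Section EvenFunctor.
Variables (C D : supercat) (F : superfunctor C D).
Definition even_fun_hom (X Y : even_cat C) (f : cat_hom X Y) :
    @cat_hom (even_cat D) (F X) (F Y) :=
  exist _ (sf_hom F (val f)) (sf_hom_grad F (valP f)).
Lemma even_fun_id (X : even_cat C) :
  even_fun_hom (cat_id X) = @cat_id (even_cat D) (F X).
Proof. by apply: val_inj; exact: sf_id. Qed.
Lemma even_fun_comp (X Y Z : even_cat C) (g : cat_hom Y Z) (f : cat_hom X Y) :
  even_fun_hom (cat_comp g f) = cat_comp (even_fun_hom g) (even_fun_hom f).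
Proof. by apply: val_inj; exact: sf_comp. Qed.
Definition even_functor : functor (even_cat C) (even_cat D) :=
  Functor even_fun_id even_fun_comp.
End EvenFunctor.

Section SuperfunctorComp.
Variables (C D E : supercat) (G : superfunctor D E) (F : superfunctor C D).
Let comp_hom (X Y : C) (f : sc_hom X Y) : sc_hom (G (F X)) (G (F Y)) :=
  sf_hom G (sf_hom F f).
Lemma sf_comp_homD (X Y : C) : {morph @comp_hom X Y : f g / f + g}.
Proof. by move=> f g; rewrite /comp_hom !sf_homD. Qed.
Lemma sf_comp_grad (X Y : C) i (f : sc_hom X Y) : f \in sa_grad (sc_hom X Y) i ->
  comp_hom f \in sa_grad (sc_hom (G (F X)) (G (F Y))) i.
Proof. by move=> fi; do 2!apply: sf_hom_grad. Qed.
Lemma sf_comp_id (X : C) : comp_hom (sc_id X) = sc_id (G (F X)).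
Proof. by rewrite /comp_hom !sf_id. Qed.
Lemma sf_comp_comp (X Y Z : C) (g : sc_hom Y Z) (f : sc_hom X Y) :
  comp_hom (sc_comp g f) = sc_comp (comp_hom g) (comp_hom f).
Proof. by rewrite /comp_hom !sf_comp. Qed.
Definition superfunctor_comp : superfunctor C E :=
  Superfunctor sf_comp_homD sf_comp_grad sf_comp_id sf_comp_comp.
End SuperfunctorComp.

(* Isomorphism of superfunctors: even components, natural with respect to all
   morphisms, even and odd.  Naturality in even morphisms alone is weaker: over
   S = k[e], e odd, e^2 = 1, char k <> 2, let P be S with left action twisted by
   e |-> - e.  Then x |-> (-1)^|x| x identifies - (x) P with the identity
   naturally in even morphisms, but P and S are not isomorphic bimodules. *)
Definition super_nat_iso (C D : supercat) (F G : superfunctor C D) : Prop :=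
  exists eta : forall X : C, @cat_hom (even_cat D) (F X) (G X),
    (forall X, cat_iso (eta X)) /\
    (forall (X Y : C) (f : sc_hom X Y),
      sc_comp (val (eta Y)) (sf_hom F f) = sc_comp (sf_hom G f) (val (eta X))).

Section ModuleCategory.
Variable R : superRing.
Implicit Types L M N : rmod R.

Definition rcomp L M N (g : rHom M N) (f : rHom L M) : rHom L N := g \o f.

Lemma rcompDl L M N (f : rHom L M) : {morph (fun g : rHom M N => rcomp g f) : g h / g + h}.
Proof. by move=> g h; apply: linear_ext. Qed.
Lemma rcompDr L M N (g : rHom M N) : {morph (fun f : rHom L M => rcomp g f) : f h / f + h}.
Proof. by move=> f h; apply: linear_ext => x; exact: raddfD. Qed.
Lemma rcompA K L M N (h : rHom M N) (g : rHom L M) (f : rHom K L) :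
  rcomp h (rcomp g f) = rcomp (rcomp h g) f.
Proof. exact: linear_ext. Qed.
Lemma rcomp1f M N (f : rHom M N) : rcomp (idfun : rHom N N) f = f.
Proof. exact: linear_ext. Qed.
Lemma rcompf1 M N (f : rHom M N) : rcomp f (idfun : rHom M M) = f.
Proof. exact: linear_ext. Qed.

Definition sMod : supercat :=
  Supercat (@rhom_id_even R) (@rhom_comp_parity R) rcompDl rcompDr rcompA
    rcomp1f rcompf1.

(* The category of right graded modules and parity-preserving homomorphisms. *)
Definition Mod : category := even_cat sMod.

Definition short_exact (A B C : zmodType) (f : A -> B) (g : B -> C) : Prop :=
  [/\ injective f, forall y, g y = 0 <-> exists x, f x = y &
      forall z, exists y, g y = z].

Definition projective (P : Mod) : Prop :=
  forall (L M N : Mod) (f : even_hom L M) (g : even_hom M N),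
    short_exact (val f : {linear _ -> _}) (val g : {linear _ -> _}) ->
    short_exact (fun h : even_hom P L => even_comp f h)
                (fun h : even_hom P M => even_comp g h).

(* Hom_R(P, -) with all homomorphisms, even and odd, is faithful. *)
Definition generator (P : Mod) : Prop :=
  forall (M N : Mod) (f : even_hom M N),
    (forall h : rHom P M, rcomp (val f) h = 0) -> f = 0.

Definition finitely_generated (P : rmod R) : Prop :=
  exists n (g : 'I_n -> P), forall x, exists c : 'I_n -> R,
    x = \sum_i (c i : R^c) *: g i.

Definition progenerator (P : rmod R) : Prop :=
  [/\ finitely_generated P, projective P & generator P].

End ModuleCategory.

Definition bimod_progenerator (S R : superRing) (P : bimod S R) : Prop :=
  faithfully_balanced P /\ progenerator P.

Definition bimod_iso (S R : superRing) (P Q : bimod S R) : Prop :=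
  exists f : {linear P -> Q},
    [/\ bijective f, forall s x, f (lact s x) = lact s (f x) &
        has_parity (rm_grad P) (rm_grad Q) false f].

Section TensorFunctor.
Variables (S R : superRing) (P : bimod S R).

Let tob (M : sMod S) : sMod R := tensor M P.
Let thom (M N : sMod S) (f : sc_hom M N) : sc_hom (tob M) (tob N) := tmap P f.

Lemma thomD (M N : sMod S) : {morph @thom M N : f g / f + g}.
Proof.
move=> f g; apply: tmap_eq => m p; rewrite /thom lin_addE !tmapE.
exact: tpureDl.
Qed.

Lemma thom_grad (M N : sMod S) i (f : sc_hom M N) :
  f \in sa_grad (sc_hom M N) i -> thom f \in sa_grad (sc_hom (tob M) (tob N)) i.
Proof. exact: tmap_parity. Qed.

Lemma thom_id (M : sMod S) : thom (sc_id M) = sc_id (tob M).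
Proof. by apply: tmap_eq => m p; rewrite /thom tmapE. Qed.

Lemma thom_comp (L M N : sMod S) (g : sc_hom M N) (f : sc_hom L M) :
  thom (sc_comp g f) = sc_comp (thom g) (thom f).
Proof.
apply: tmap_eq => m p; rewrite [LHS]tmapE.
change (tpure (g (f m)) p = tmap P g (tmap P f (tpure m p))).
by rewrite [X in tmap P g X]tmapE [RHS]tmapE.
Qed.

(* - (x)_S P *)
Definition tensor_functor : superfunctor (sMod S) (sMod R) :=
  Superfunctor thomD thom_grad thom_id thom_comp.
End TensorFunctor.

(* An equivalence Mod S -> Mod R of the categories of graded modules and even
   homomorphisms, given together with its action on odd homomorphisms. *)
Definition module_equivalence (S R : superRing)
    (F : superfunctor (sMod S) (sMod R)) : Prop :=
  @is_equivalence (Mod S) (Mod R) (even_functor F).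

(* Main.v *)
(* An equivalence F is determined by P = F(S), on which S acts through the
   endomorphisms F(s).  Since S is a generator, so is P, and writing
   1 = sum_k f_k(q_k) with f_k : P -> R and q_k in P, the map
   x |-> sum_k F^-1(x f_k)(1) (x) q_k inverts the natural map
   M (x)_S P -> F(M), m (x) p |-> F(s |-> m s)(p), where x f_k : P -> F(M) is
   p |-> x f_k(p).  The same formula shows that Hom_R(P, X) (x)_S P -> X is
   invertible when P is a progenerator, whence essential surjectivity of
   - (x)_S P; full faithfulness comes from a dual basis of P, because
   (m (x) p) g(p') = m [p g] (x) p', [p g] in S being the endomorphism
   x |-> p g(x).  Conversely, if F(Y) = R then Y is a generator, and the image
   under F of the relation 1 = sum_j u_j(y_j) in S is a dual basis of F(S). *)

Require Import Defs.
From HB Require Import structures.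
From mathcomp Require Import all_boot all_order all_algebra.
From mathcomp Require Import boolp.

Set Implicit Arguments.
Unset Strict Implicit.
Unset Printing Implicit Defensive.

Import GRing.Theory.
Local Open Scope ring_scope.
Local Open Scope quotient_scope.

(** [module_equivalence] speaks of even morphisms only, whereas the argument needs full faithfulness
    on all maps, because odd elements of [S] act on [F(S)] through odd endomorphisms;
    [sf_equivalence] is the form actually used. Two observations keep parities out of most of the
    proof. An even map that is bijective as a function has a linear even inverse, so the inverses
    written down below are mere functions. Trace relations and dual bases are arbitrary finite
    families, and evenness is restored at the end by taking even parts. Homogeneous families are
    needed to cover [P] by a graded free module, and in the double centralizer, where the signs of
    [right_mul] and of left linear maps must match. That [P (x)_R P'] is a progenerator is not
    checked on the tensor product itself: any bimodule whose functor is isomorphic to an equivalence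
    is a progenerator. *)

Lemma inj_surj_bij (A B : Type) (f : A -> B) :
  injective f -> (forall y, exists x, f x = y) -> bijective f.
Proof.
move=> fi fs; exists (fun y => sval (cid (fs y))) => [x|y]; last by case: cid.
by apply: fi; case: cid.
Qed.

(** The component of [x] of the other parity is sent into both parts of [B], hence to zero. This is
    what makes inverses of even bijections even, and what recovers parities of preimages under [F]
    and under [left_mul]. *)
Lemma parity_inj_mem (M N : zmodType) (A : grading M) (B : grading N) (f : M -> N) i x :
  {morph f : x y / x + y} -> injective f -> has_parity A B false f ->
  f x \in B i -> x \in A i.
Proof.
move=> fD fi fP fx; have xE : x = gproj A i x + gproj A (~~ i) x.
  by case: (i); rewrite [LHS](gproj_sum A) // addrC.
have fj : f (gproj A (~~ i) x) \in B (~~ i).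
  by have := fP _ _ (gprojP A (~~ i) x); rewrite addFb.
have fj' : f (gproj A (~~ i) x) \in B i.
  move: fx; rewrite {1}xE fD addrC => fx; rewrite -[X in X \in _](addrK (f (gproj A i x))).
  by rewrite rpredB //; have := fP _ _ (gprojP A i x); rewrite addFb.
have ij : i != ~~ i by case: (i).
have x0 : gproj A (~~ i) x = 0.
  by apply: fi; rewrite (morphD0 fD); exact: gpart_disj ij fj' fj.
by rewrite xE x0 addr0 gprojP.
Qed.

(** * Constructions of graded modules *)

Section Regular.
Variable S : superRing.

Lemma rreg_gradM i j (x : S^c^o) (r : S) : x \in sr_grad S i -> r \in sr_grad S j ->
  (r : S^c) *: x \in sr_grad S (i (+) j).
Proof. exact: sr_gradM. Qed.

Definition rreg : rmod S := @Rmod S S^c^o (sr_grad S) rreg_gradM.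

Lemma rreg_ractE (r : S^c) (x : rreg) : r *: x = (x : S) * r.
Proof. by []. Qed.

Variable M : rmod S.

Lemma ptmap_linear (m : M) : linear (fun s : rreg => (s : S^c) *: m).
Proof. by move=> r s t; rewrite scalerDl scalerA. Qed.

(** The Yoneda correspondence between elements of [M] and maps out of the regular module. For [M]
    the regular module itself it is left multiplication by [m]; composed with a functional [P -> R]
    it gives the rank one maps. *)
Definition ptmap (m : M) : rHom rreg M :=
  (HB.pack (fun s : rreg => (s : S^c) *: m)
     (GRing.isLinear.Build S^c rreg M *:%R _ (ptmap_linear m)) : {linear rreg -> M}).

Lemma ptmapE m (s : S) : (ptmap m : {linear rreg -> M}) (s : rreg) = (s : S^c) *: m.
Proof. by []. Qed.

Lemma ptmap1 m : (ptmap m : {linear rreg -> M}) (1 : S) = m.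
Proof. exact: scale1r. Qed.

Lemma ptmapD : {morph ptmap : m n / m + n}.
Proof. by move=> m n; apply: linear_ext => s /=; rewrite scalerDr. Qed.

Lemma ptmap_eq (f : rHom rreg M) : f = ptmap ((f : {linear rreg -> M}) (1 : S)).
Proof.
apply: linear_ext => s; rewrite ptmapE -linearZ.
by congr (f _); rewrite rreg_ractE mul1r.
Qed.

Lemma ptmap_parity i m : m \in rm_grad M i -> ptmap m \in sa_grad (rHom rreg M) i.
Proof. by move=> mM; apply/asboolP => j s sS; exact: rm_gradM. Qed.

End Regular.

Section Shift.
Variables (R : superRing) (M : rmod R).

Lemma shift_direct (x : M) : exists! p : M * M,
  [/\ p.1 \in rm_grad M (~~ false), p.2 \in rm_grad M (~~ true) & x = p.1 + p.2].
Proof.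
move: x; apply: (grading_mk (A := fun i => rm_grad M (~~ i))) => x.
  by move=> x1 x0; exact: (gpart_disj (A := rm_grad M) (i := true) (j := false)).
exists (gproj (rm_grad M) true x), (gproj (rm_grad M) false x).
by split; [exact: gprojP..|rewrite addrC -gproj_sum].
Qed.

Definition shift_grad : grading M := @Grading M (fun i => rm_grad M (~~ i)) shift_direct.

Lemma shift_gradM i j (x : M) (r : R) : x \in shift_grad i -> r \in sr_grad R j ->
  (r : R^c) *: x \in shift_grad (i (+) j).
Proof. by move=> xM rR; rewrite /shift_grad /= -addNb; exact: rm_gradM. Qed.

(** The parity shift. On right modules the action keeps its sign, so the identity function is an odd
    isomorphism. *)
Definition shift_rmod : rmod R := @Rmod R M shift_grad shift_gradM.

Definition to_shift : rHom M shift_rmod := idfun : {linear M -> M}.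
Definition of_shift : rHom shift_rmod M := idfun : {linear M -> M}.

Lemma to_shift_odd : to_shift \in sa_grad (rHom M shift_rmod) true.
Proof. by apply/asboolP => j x xM; rewrite /shift_rmod /= negbK. Qed.
End Shift.

Section Quotient.
Variables (R : superRing) (M : rmod R) (T : zmodClosed M).
Hypothesis TZ : forall (r : R^c) x, x \in T -> r *: x \in T.
Hypothesis Tproj : forall i x, x \in T -> gproj (rm_grad M) i x \in T.

Definition quo : Type := Quotient.quot T.
HB.instance Definition _ := GRing.Zmodule.on quo.

Definition qpi : M -> quo := \pi_(Quotient.quot T).
Lemma qpiB : zmod_morphism qpi.
Proof. by move=> x y; exact: raddfB. Qed.
HB.instance Definition _ := GRing.isZmodMorphism.Build M quo qpi qpiB.

Lemma qpi_eq0 x : (qpi x == 0) = (x \in T).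
Proof. by rewrite -(raddf0 qpi) /qpi -Quotient.idealrBE subr0. Qed.

Lemma qpi_repr (y : quo) : qpi (repr y) = y.
Proof. by rewrite /qpi reprK. Qed.

Definition quo_scale (r : R^c) (y : quo) : quo := qpi (r *: repr y).

Lemma quo_scaleE r x : quo_scale r (qpi x) = qpi (r *: x).
Proof.
apply/eqP; rewrite -subr_eq0 -raddfB qpi_eq0 -scalerBr TZ //.
by rewrite -qpi_eq0 raddfB /= qpi_repr subrr.
Qed.

Lemma quo_scaleA r s y : quo_scale r (quo_scale s y) = quo_scale (r * s) y.
Proof. by rewrite -(qpi_repr y) !quo_scaleE scalerA. Qed.
Lemma quo_scale1 : left_id 1 quo_scale.
Proof. by move=> y; rewrite -(qpi_repr y) quo_scaleE scale1r. Qed.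
Lemma quo_scaleDr : right_distributive quo_scale +%R.
Proof.
move=> r x y; rewrite -(qpi_repr x) -(qpi_repr y) -raddfD !quo_scaleE.
by rewrite scalerDr raddfD.
Qed.
Lemma quo_scaleDl y : {morph quo_scale^~ y : r s / r + s}.
Proof. by move=> r s; rewrite -(qpi_repr y) !quo_scaleE scalerDl raddfD. Qed.

Definition quo_lmod : lmodType R^c :=
  HB.pack quo (GRing.Zmodule_isLmodule.Build R^c quo
    quo_scaleA quo_scale1 quo_scaleDr quo_scaleDl).

Definition quo_pred i : {pred quo_lmod} :=
  fun y => `[< exists2 x, x \in rm_grad M i & qpi x = y >].
Lemma quo_predB i : zmod_closed (quo_pred i).
Proof.
split=> [|x y /asboolP[a aM <-] /asboolP[b bM <-]]; apply/asboolP.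
  by exists 0; rewrite ?rpred0 ?raddf0.
by exists (a - b); rewrite ?rpredB // raddfB.
Qed.
HB.instance Definition _ i :=
  GRing.isZmodClosed.Build quo_lmod (quo_pred i) (quo_predB i).

Lemma quo_direct (y : quo_lmod) : exists! p : quo_lmod * quo_lmod,
  [/\ p.1 \in quo_pred false, p.2 \in quo_pred true & y = p.1 + p.2].
Proof.
move: y; apply: (grading_mk (A := fun i => quo_pred i)) => y.
  move=> /asboolP[a aM <-] /asboolP[b bM E].
  apply/eqP; change (qpi a == 0); rewrite qpi_eq0.
  (* The even component of [a - b] is [a], and [T] contains the components of its elements, so the
     common class is zero. *)
  have /(Tproj false) : a - b \in T.
    by rewrite -qpi_eq0 raddfB subr_eq0; apply/eqP; exact: esym.
  by rewrite raddfB /= (gproj_id _ aM) (gproj_id _ bM) /= subr0.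
exists (qpi (gproj (rm_grad M) false (repr y))), (qpi (gproj (rm_grad M) true (repr y))).
split.
- by apply/asboolP; exists (gproj (rm_grad M) false (repr y)); rewrite ?gprojP.
- by apply/asboolP; exists (gproj (rm_grad M) true (repr y)); rewrite ?gprojP.
by rewrite -[LHS]qpi_repr {1}(gproj_sum (rm_grad M) (repr y)) raddfD.
Qed.

Definition quo_grad : grading quo_lmod := Grading quo_direct.

Lemma quo_gradM i j (y : quo_lmod) (r : R) : y \in quo_grad i -> r \in sr_grad R j ->
  (r : R^c) *: y \in quo_grad (i (+) j).
Proof.
move=> /asboolP[x xM <-] rR; apply/asboolP; exists ((r : R^c) *: x).
  exact: rm_gradM.
exact: esym (quo_scaleE r x).
Qed.

Definition quo_rmod : rmod R := @Rmod R quo_lmod quo_grad quo_gradM.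

Lemma quo_proj_linear : linear (qpi : M -> quo_rmod).
Proof. by move=> r x y; rewrite raddfD; congr (_ + _); exact: esym (quo_scaleE r x). Qed.

Definition quo_proj : rHom M quo_rmod :=
  (HB.pack (qpi : M -> quo_rmod)
    (GRing.isLinear.Build R^c M quo_rmod *:%R _ quo_proj_linear) : {linear M -> quo_rmod}).

Lemma quo_proj_even : quo_proj \in sa_grad (rHom M quo_rmod) false.
Proof. by apply/asboolP => j x xM; apply/asboolP; exists x. Qed.

Lemma quo_proj_eq0 x : ((quo_proj : {linear M -> quo_rmod}) x == 0) = (x \in T).
Proof. exact: qpi_eq0. Qed.
End Quotient.

Section Kernel.
Variables (R : superRing) (M N : rmod R) (f : {linear M -> N}).
Hypothesis f_even : (f : rHom M N) \in sa_grad (rHom M N) false.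

Definition ker_pred : {pred M} := fun x => f x == 0.
Lemma ker_submod : submod_closed ker_pred.
Proof.
split=> [|r x y]; rewrite !unfold_in ?raddf0 //.
by move=> /eqP fx /eqP fy; rewrite linearP fx fy scaler0 addr0.
Qed.
HB.instance Definition _ := GRing.isSubmodClosed.Build R^c M ker_pred ker_submod.

Definition ker_type : Type := {x : M | x \in ker_pred}.
HB.instance Definition _ := SubChoice.on ker_type.
HB.instance Definition _ := [SubChoice_isSubLmodule of ker_type by <:].

Lemma kerP (x : ker_type) : f (val x) = 0.
Proof. by apply/eqP; exact: (valP x). Qed.

Definition ker_part i : {pred ker_type} := fun x => val x \in rm_grad M i.
Lemma ker_partB i : zmod_closed (ker_part i).
Proof.
split=> [|x y xM yM]; first exact: (rpred0 (rm_grad M i)).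
change (val (x - y) \in rm_grad M i); rewrite raddfB.
exact: (@rpredB _ (rm_grad M i)).
Qed.
HB.instance Definition _ i :=
  GRing.isZmodClosed.Build ker_type (ker_part i) (ker_partB i).

Lemma ker_proj i x : x \in ker_pred -> gproj (rm_grad M) i x \in ker_pred.
Proof.
rewrite !unfold_in => /eqP fx; have /asboolP fP := f_even.
have := fx; rewrite {1}(gproj_sum (rm_grad M) x) raddfD.
move=> /(congr1 (gproj (rm_grad N) i)); rewrite raddfD /= raddf0.
rewrite !(gproj_id _ (fP _ _ (gprojP (rm_grad M) _ _))).
by case: i => /=; rewrite ?add0r ?addr0 => ->.
Qed.

Lemma ker_direct (x : ker_type) : exists! p : ker_type * ker_type,
  [/\ p.1 \in ker_part false, p.2 \in ker_part true & x = p.1 + p.2].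
Proof.
move: x; apply: (grading_mk (A := fun i => ker_part i)) => x.
  move=> x0 x1; apply: val_inj.
  exact: (gpart_disj (A := rm_grad M) (i := false) (j := true)).
pose pr i : ker_type :=
  exist (fun y => y \in ker_pred) (gproj (rm_grad M) i (val x)) (ker_proj i (valP x)).
exists (pr false), (pr true); split; try exact: gprojP.
by apply: val_inj; rewrite raddfD /= -gproj_sum.
Qed.

Definition ker_grad : grading ker_type := Grading ker_direct.

Lemma ker_gradM i j (x : ker_type) (r : R) : x \in ker_grad i -> r \in sr_grad R j ->
  (r : R^c) *: x \in ker_grad (i (+) j).
Proof. by move=> xM rR; exact: (@rm_gradM _ M i j (val x) r). Qed.

Definition ker_rmod : rmod R := @Rmod R ker_type ker_grad ker_gradM.

Lemma ker_incl_linear : linear (val : ker_rmod -> M).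
Proof. by []. Qed.

Definition ker_incl : rHom ker_rmod M :=
  (HB.pack (val : ker_rmod -> M)
    (GRing.isLinear.Build R^c ker_rmod M *:%R _ ker_incl_linear) : {linear ker_rmod -> M}).

Lemma ker_incl_even : ker_incl \in sa_grad (rHom ker_rmod M) false.
Proof. by apply/asboolP => j x. Qed.

(** Since [projective] is phrased with short exact sequences, lifting along a surjection requires
    its kernel as a graded module. *)
Lemma ker_exact (fs : forall y, exists x, f x = y) :
  short_exact (ker_incl : {linear ker_rmod -> M}) f.
Proof.
split=> [x y||//]; first exact: val_inj.
move=> x; split=> [fx|[k <-]]; last exact: kerP.
have xk : x \in ker_pred by apply/eqP.
by exists (exist (fun y => y \in ker_pred) x xk).
Qed.
End Kernel.

(* The free module on I whose i-th basis vector has parity e i. *)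
Section Free.
Variables (R : superRing) (I : finType) (e : I -> bool).

Definition free_car : Type := {ffun I -> R^c^o}.
HB.instance Definition _ := GRing.Lmodule.on free_car.

(** The [i]-th term has the parity of its coefficient plus [e i], so degree [k] forces the
    coefficient into degree [e i (+) k]. *)
Definition free_part k : {pred free_car} :=
  fun x => `[< forall i, (x i : R) \in sr_grad R (e i (+) k) >].
Lemma free_partB k : zmod_closed (free_part k).
Proof.
split=> [|x y /asboolP xP /asboolP yP]; apply/asboolP => i.
  by rewrite ffunE; exact: (rpred0 (sr_grad R _)).
by rewrite !ffunE; exact: (@rpredB _ (sr_grad R _)).
Qed.
HB.instance Definition _ k :=
  GRing.isZmodClosed.Build free_car (free_part k) (free_partB k).

Lemma free_direct (x : free_car) : exists! p : free_car * free_car,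
  [/\ p.1 \in free_part false, p.2 \in free_part true & x = p.1 + p.2].
Proof.
move: x; apply: (grading_mk (A := fun k => free_part k)) => x.
  move=> /asboolP x0 /asboolP x1; apply/ffunP => i; rewrite ffunE.
  apply: (gpart_disj (A := sr_grad R)) (x0 i) (x1 i).
  by case: (e i).
pose pr k : free_car := [ffun i => gproj (sr_grad R) (e i (+) k) (x i : R)].
exists (pr false), (pr true); split.
- by apply/asboolP => i; rewrite ffunE; exact: gprojP.
- by apply/asboolP => i; rewrite ffunE; exact: gprojP.
apply/ffunP => i; rewrite !ffunE addbF addbT.
by rewrite {1}(gproj_sum (sr_grad R) (x i : R)); case: (e i) => //=; rewrite addrC.
Qed.

Definition free_grad : grading free_car := Grading free_direct.

Lemma free_gradM i j (x : free_car) (r : R) : x \in free_grad i -> r \in sr_grad R j ->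
  (r : R^c) *: x \in free_grad (i (+) j).
Proof.
move=> /asboolP xM rR; apply/asboolP => k; rewrite ffunE addbA.
exact: sr_gradM (xM k) rR.
Qed.

Definition free_rmod : rmod R := @Rmod R free_car free_grad free_gradM.

Lemma coord_linear i : linear (fun x : free_rmod => x i : rreg R).
Proof. by move=> r x y; rewrite !ffunE. Qed.

Definition coordf i : rHom free_rmod (rreg R) :=
  (HB.pack (fun x : free_rmod => x i : rreg R)
    (GRing.isLinear.Build R^c free_rmod (rreg R) *:%R _ (coord_linear i)) :
    {linear free_rmod -> rreg R}).

Variables (M : rmod R) (g : I -> M).

Lemma comb_linear : linear (fun x : free_rmod => \sum_i (x i : R^c) *: g i).
Proof.
move=> r x y; rewrite scaler_sumr -big_split; apply: eq_bigr => i _ /=.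
by rewrite !ffunE scalerDl scalerA.
Qed.

Definition comb : rHom free_rmod M :=
  (HB.pack (fun x : free_rmod => \sum_i (x i : R^c) *: g i)
    (GRing.isLinear.Build R^c free_rmod M *:%R _ comb_linear) : {linear free_rmod -> M}).

Lemma comb_even : (forall i, g i \in rm_grad M (e i)) ->
  comb \in sa_grad (rHom free_rmod M) false.
Proof.
move=> gM; apply/asboolP => j x /asboolP xP; apply: rpred_sum => i _.
by have := rm_gradM (gM i) (xP i); rewrite addbA addbb.
Qed.
End Free.

Local Notation lin f := (f : {linear _ -> _}) (only parsing).

(** * Trace and dual bases *)

Section RHom.
Variable R : superRing.
Implicit Types L M N : rmod R.

Lemma rhomP M N i (f : rHom M N) :
  (f \in sa_grad (rHom M N) i) <-> has_parity (rm_grad M) (rm_grad N) i (lin f).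
Proof. by split=> [/asboolP|fP]; [|apply/asboolP]. Qed.

Definition mk_even M N (f : rHom M N) (fP : f \in sa_grad (rHom M N) false) :
    even_hom (C := sMod R) M N :=
  exist (fun g => g \in sa_grad (rHom M N) false) f fP.

Lemma rhom_part_mem M N i (f : rHom M N) : rhom_part i f \in sa_grad (rHom M N) i.
Proof. by apply/rhomP/part_fun_parity; exact: raddfB. Qed.

Lemma rhom_part_sum M N (f : rHom M N) : f = rhom_part false f + rhom_part true f.
Proof. by apply: linear_ext => x; apply: part_fun_sum; exact: raddfB. Qed.

Lemma parity_gproj M N i j (f : rHom M N) x : f \in sa_grad (rHom M N) i ->
  gproj (rm_grad N) (i (+) j) (lin f x) = lin f (gproj (rm_grad M) j x).
Proof.
move=> /rhomP fP; move: x; apply: (homog_eq (A := rm_grad M)) => [x y|x y|k x xM].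
- by rewrite !raddfD.
- by rewrite !raddfD.
rewrite (gproj_id _ (fP _ _ xM)) (gproj_id _ xM).
by case: i j k {fP xM} => -[] [] /=; rewrite ?raddf0.
Qed.

Lemma even_gproj M N j (f : even_hom (C := sMod R) M N) x :
  gproj (rm_grad N) j (lin (val f) x) = lin (val f) (gproj (rm_grad M) j x).
Proof. exact: (parity_gproj j x (valP f)). Qed.

Lemma even_inj_mem M N j (f : rHom M N) x : f \in sa_grad (rHom M N) false ->
  injective (lin f) -> lin f x \in rm_grad N j -> x \in rm_grad M j.
Proof. by move=> /rhomP f0 fi; apply: parity_inj_mem => // y z; exact: raddfD. Qed.

Lemma rhom_sumE M N (I : Type) (s : seq I) (f : I -> rHom M N) x :
  lin (\sum_(i <- s) f i) x = \sum_(i <- s) lin (f i) x.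
Proof. by elim/big_rec2: _ => // i y g _ <-. Qed.

Lemma even_hom_eq M N (f g : even_hom (C := sMod R) M N) :
  lin (val f) =1 lin (val g) -> f = g.
Proof. by move=> fg; apply: val_inj; exact: linear_ext. Qed.

(** The inverse function is linear by injectivity of [f], and even because [f] reflects parities. *)
Lemma cat_iso_even M N (f : even_hom (C := sMod R) M N) :
  bijective (lin (val f)) -> @cat_iso (Mod R) M N f.
Proof.
case=> g fK gK.
have gl : linear g.
  by move=> r x y; apply: (can_inj fK); rewrite linearP !gK.
pose h : {linear N -> M} := HB.pack g (GRing.isLinear.Build R^c N M *:%R _ gl).
have h0 : (h : rHom N M) \in sa_grad (rHom N M) false.
  apply/rhomP => j x xN; apply: (even_inj_mem (valP f) (can_inj fK)).
  by rewrite addFb; change (lin (val f) (g x) \in rm_grad N j); rewrite gK.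
by exists (mk_even h0); split; apply: even_hom_eq.
Qed.

Lemma cat_isoK M N (f : even_hom (C := sMod R) M N) : @cat_iso (Mod R) M N f ->
  exists g : even_hom (C := sMod R) N M,
    cancel (lin (val f)) (lin (val g)) /\ cancel (lin (val g)) (lin (val f)).
Proof.
case=> g [gf fg]; exists g; split=> x.
  exact: (congr1 (fun h : even_hom (C := sMod R) M M => lin (val h) x) gf).
exact: (congr1 (fun h : even_hom (C := sMod R) N N => lin (val h) x) fg).
Qed.

(** Preimages under [f] are unique, so choosing them pointwise already gives a linear even map. This
    is the left exactness of Hom. *)
Lemma even_lift L M N (f : even_hom (C := sMod R) L M) (h : even_hom (C := sMod R) N M) :
  injective (lin (val f)) -> (forall x, exists y, lin (val f) y = lin (val h) x) ->
  exists k, even_comp f k = h.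
Proof.
move=> fi fh; pose k x := sval (cid (fh x)).
have kE x : lin (val f) (k x) = lin (val h) x by rewrite /k; case: cid.
have kl : linear k by move=> r x y; apply: fi; rewrite linearP !kE linearP.
pose k' : {linear N -> L} := HB.pack k (GRing.isLinear.Build R^c N L *:%R _ kl).
have k0 : (k' : rHom N L) \in sa_grad (rHom N L) false.
  apply/rhomP => j x xN; apply: (even_inj_mem (valP f) fi).
  change (lin (val f) (k x) \in rm_grad M j); rewrite kE.
  by have /rhomP hP := valP h; exact: hP.
by exists (mk_even k0); apply: even_hom_eq.
Qed.

End RHom.

Section Trace.
Variables (R : superRing) (P : rmod R).
Hypothesis P_gen : @generator R P.

Definition trace_val (y : rreg R) : Prop :=
  exists (h : rHom P (rreg R)) (p : P), y = lin h p.

Definition trace_ideal : zmodClosed (rreg R) := Defs.span trace_val.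

Lemma trace_idealZ (r : R^c) (x : rreg R) : x \in trace_ideal -> r *: x \in trace_ideal.
Proof.
move: x; apply: span_ind => [|x y xP yP|_ [h [p ->]]].
- by rewrite scaler0 rpred0.
- by rewrite scalerBr rpredB.
- by apply: mem_span; exists h, (r *: p); rewrite linearZ.
Qed.

Lemma trace_ideal_proj i (x : rreg R) :
  x \in trace_ideal -> gproj (rm_grad (rreg R)) i x \in trace_ideal.
Proof.
move: x; apply: span_ind => [|x y xP yP|_ [h [p ->]]].
- by rewrite raddf0 rpred0.
- by rewrite raddfB rpredB.
rewrite (rhom_part_sum h) lin_addE raddfD.
have hP e : gproj (rm_grad (rreg R)) i (rhom_part e h p) \in trace_ideal.
  have := parity_gproj (e (+) i) p (rhom_part_mem e h).
  rewrite addbA addbb addFb => ->; apply: mem_span.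
  by exists (rhom_part e h), (gproj (rm_grad P) (e (+) i) p).
by apply: rpredD; exact: hP.
Qed.

(** The projection of [R] onto its quotient by the trace ideal vanishes after composition with any
    map [P -> R]. Since [P] is a generator, the projection itself is zero. *)
Lemma trace_ideal1 : (1 : R) \in trace_ideal.
Proof.
pose q := quo_proj trace_idealZ trace_ideal_proj.
pose f : even_hom (C := sMod R) (rreg R) _ :=
  mk_even (f := q) (quo_proj_even trace_idealZ trace_ideal_proj).
have f0 : f = 0.
  apply: P_gen => h; apply: linear_ext => x; apply/eqP.
  by rewrite [_ == _]quo_proj_eq0; apply: mem_span; exists h, x.
rewrite -(quo_proj_eq0 trace_idealZ trace_ideal_proj) -/q.
by rewrite -[q]/(val f) f0.
Qed.

(** The form in which the generator property is used from here on; neither the maps nor the elements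
    are homogeneous. *)
Lemma generator_trace : exists s : seq (rHom P (rreg R) * P),
  (1 : R) = \sum_(u <- s) (lin u.1 u.2 : rreg R).
Proof.
move: trace_ideal1; move: (1 : R); apply: span_ind => [|x y [s xE] [t yE]|_ [h [p ->]]].
- by exists [::]; rewrite big_nil.
- exists (s ++ [seq (- u.1, u.2) | u <- t]); rewrite big_cat big_map /= xE yE.
  by rewrite -sumrN.
- by exists [:: (h, p)]; rewrite big_seq1.
Qed.
End Trace.

Section DualBasis.
Variables (R : superRing) (P : rmod R).

Definition dual_basis (s : seq (P * rHom P (rreg R))) : Prop :=
  forall x, x = \sum_(u <- s) (lin u.2 x : R^c) *: u.1.

(** A surjection from a graded free module onto [P] splits, and the coordinates of a section are the
    functionals of the dual basis. *)
Lemma fg_projective_dual_basis : finitely_generated P -> @projective R P ->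
  exists s, dual_basis s.
Proof.
move=> [n [g gP]] Pproj.
(* Each generator is replaced by its even and odd components, so that the map from the free module
   can be even. *)
pose e (i : 'I_n * bool) := i.2.
pose p (i : 'I_n * bool) := gproj (rm_grad P) i.2 (g i.1).
pose f : even_hom (C := sMod R) (free_rmod R e) P :=
  mk_even (comb_even (e := e) (g := p) (fun i => gprojP _ _ _)).
have fs y : exists x, lin (val f) x = y.
  have [c ->] := gP y; exists [ffun i => c i.1 : R^c^o].
  change (\sum_i ([ffun i => c i.1 : R^c^o] i : R^c) *: p i = \sum_i (c i : R^c) *: g i).
  rewrite (eq_bigr (fun i => (c i.1 : R^c) *: gproj (rm_grad P) i.2 (g i.1))); last first.
    by move=> i _; rewrite ffunE.
  rewrite -(pair_bigA _ (fun i b => (c i : R^c) *: gproj (rm_grad P) b (g i))) /=.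
  apply: eq_bigr => i _.
  by rewrite big_bool [in RHS](gproj_sum (rm_grad P) (g i)) [RHS]scalerDr addrC.
pose k : even_hom (C := sMod R) (ker_rmod (valP f)) (free_rmod R e) :=
  mk_even (ker_incl_even (valP f)).
have [_ _ /(_ (even_id (C := sMod R) P)) [h hE]] :=
  Pproj _ _ _ k f (ker_exact (valP f) fs).
exists [seq (p i, rcomp (coordf R e i) (val h)) | i <- enum {: 'I_n * bool}] => x.
rewrite big_map big_enum.
exact: (esym (congr1 (fun h : even_hom (C := sMod R) P P => lin (val h) x) hE)).
Qed.

Variable s : seq (P * rHom P (rreg R)).
Hypothesis sP : dual_basis s.

Lemma dual_basis_fg : finitely_generated P.
Proof.
exists (size s), (fun i : 'I_(size s) => (tnth (in_tuple s) i).1) => x.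
exists (fun i => lin (tnth (in_tuple s) i).2 x : R).
by rewrite {1}(sP x) big_tnth.
Qed.

Lemma dual_basis_projective : @projective R P.
Proof.
move=> L M N f g [fi gf gs]; split=> [h k hk|h|h].
- apply: even_hom_eq => x; apply: fi.
  exact: (congr1 (fun h : even_hom (C := sMod R) P M => lin (val h) x) hk).
- split=> [gh|[k <-]]; last first.
    by apply: even_hom_eq => x; apply/gf; exists (lin (val k) x).
  apply: even_lift => // x; apply/gf.
  exact: (congr1 (fun h : even_hom (C := sMod R) P N => lin (val h) x) gh).
pose m u := sval (cid (gs (lin (val h) u))).
have mE u : lin (val g) (m u) = lin (val h) u by rewrite /m; case: cid.
pose k : rHom P M := \sum_(u <- s) rcomp (ptmap (m u.1)) u.2.
have kE x : lin (val g) (lin k x) = lin (val h) x.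
  rewrite rhom_sumE raddf_sum {2}(sP x) raddf_sum.
  apply: eq_bigr => u _.
  change (lin (val g) ((lin u.2 x : R^c) *: m u.1) =
    lin (val h) ((lin u.2 x : R^c) *: u.1)).
  by rewrite !linearZ mE.
(* [k] need not be even, as neither the dual basis nor the chosen preimages are homogeneous. Because
   [g] and [h] are even, the even part of [k] lifts [h] as well. *)
exists (mk_even (rhom_part_mem false k)).
apply: even_hom_eq; apply: (homog_eq (A := rm_grad P)) => [x y|x y|i x xP].
- by rewrite !raddfD.
- by rewrite !raddfD.
change (lin (val g) (rhom_part false k x) = lin (val h) x).
change (rhom_part false k x) with (part_fun (rm_grad P) (rm_grad M) false (lin k) x).
rewrite (part_funE _ _ (raddf0 _) xP) addFb -even_gproj kE.
by rewrite even_gproj (gproj_id _ xP) eqxx.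
Qed.
End DualBasis.

(** * Equivalences *)

Section Equivalence.
Variables (C D : category) (F : functor C D).

Definition fully_faithful : Prop := forall X Y, bijective (@fun_hom C D F X Y).
Definition essentially_surjective : Prop :=
  forall Z : D, exists (X : C) (f : cat_hom (F X) Z), cat_iso f.

Lemma is_equivalence_ff : is_equivalence F -> fully_faithful /\ essentially_surjective.
Proof.
move=> [G [[eta [etaI etaN]] [eps [epsI epsN]]]].
have Finj X Y : injective (@fun_hom C D F X Y).
  move=> f g fg; have [h [_ hK]] := etaI X.
  have := etaN _ _ g; rewrite /= -fg [LHS](etaN _ _ f) /= => /(congr1 (fun u => cat_comp u h)).
  by rewrite /= -!cat_compA hK !cat_compf1.
have Ginj X Y : injective (@fun_hom D C G X Y).
  move=> f g fg; have [h [_ hK]] := epsI X.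
  have := epsN _ _ g; rewrite /= -fg [LHS](epsN _ _ f) /= => /(congr1 (fun u => cat_comp u h)).
  by rewrite /= -!cat_compA hK !cat_compf1.
split=> [X Y|Z]; last by exists (G Z), (eps Z); exact: epsI.
apply: inj_surj_bij => // h; have [ex [exK Kex]] := etaI X.
have [ey [eyK Key]] := etaI Y.
(* The conjugate of [G h] by [eta]. Naturality shows that [G F] of this morphism and [G h] agree
   after composition with the isomorphism [eta Y]; faithfulness of [G] then gives [h]. *)
exists (cat_comp (eta Y) (cat_comp (fun_hom G h) ex)); apply: Ginj.
have := etaN _ _ (cat_comp (eta Y) (cat_comp (fun_hom G h) ex)) => /=.
rewrite -!cat_compA exK cat_compf1 => /(congr1 (fun u => cat_comp ey u)).
by rewrite !cat_compA eyK !cat_comp1f.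
Qed.

Lemma ff_is_equivalence : fully_faithful -> essentially_surjective -> is_equivalence F.
Proof.
move=> Fff Fes; pose G0 Z := sval (cid (Fes Z)).
have eex Z : exists f : cat_hom (F (G0 Z)) Z, cat_iso f by rewrite /G0; case: cid.
pose e Z := sval (cid (eex Z)).
have eI Z : cat_iso (e Z) := svalP (cid (eex Z)).
pose e' Z := sval (cid (eI Z)).
have eK Z : cat_comp (e' Z) (e Z) = cat_id _ /\ cat_comp (e Z) (e' Z) = cat_id Z :=
  svalP (cid (eI Z)).
have lift X Y (h : cat_hom (F X) (F Y)) : exists f, fun_hom F f = h.
  by have [g _ gK] := Fff X Y; exists (g h).
pose pre X Y h := sval (cid (lift X Y h)).
have preK X Y h : fun_hom F (pre X Y h) = h by rewrite /pre; case: cid.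
have Finj X Y : injective (@fun_hom C D F X Y) := bij_inj (Fff X Y).
pose G1 Z W (h : cat_hom Z W) : cat_hom (G0 Z) (G0 W) :=
  pre _ _ (cat_comp (e' W) (cat_comp h (e Z))).
have G1id Z : G1 Z Z (cat_id Z) = cat_id (G0 Z).
  by apply: Finj; rewrite preK cat_comp1f (eK Z).1 fun_id.
have G1comp X Y Z (g : cat_hom Y Z) (f : cat_hom X Y) :
    G1 X Z (cat_comp g f) = cat_comp (G1 Y Z g) (G1 X Y f).
  apply: Finj; rewrite fun_comp !preK -!cat_compA; congr (cat_comp _ (cat_comp g _)).
  by rewrite (cat_compA (e Y)) (eK Y).2 cat_comp1f.
exists (Functor G1id G1comp); split.
  exists (fun X => pre _ _ (e (F X))); split=> [X|X Y f].
    exists (pre _ _ (e' (F X))).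
    by split; apply: Finj; rewrite fun_comp !preK fun_id; case: (eK (F X)).
  apply: Finj; rewrite /= !fun_comp !preK !cat_compA.
  by rewrite (eK (F Y)).2 cat_comp1f.
exists e; split=> [Z|Z W f]; first by exists (e' Z); exact: eK.
by rewrite /= preK !cat_compA (eK W).2 cat_comp1f.
Qed.
End Equivalence.

Section ModuleEquivalence.
Variables (S R : superRing) (F : superfunctor (sMod S) (sMod R)).

Lemma sf_hom0 (X Y : rmod S) : sf_hom F (0 : rHom X Y) = 0.
Proof. exact: (morphD0 (@sf_homD _ _ F X Y)). Qed.

Lemma sf_hom_sum (X Y : rmod S) (I : Type) (s : seq I) (f : I -> rHom X Y) :
  sf_hom F (\sum_(i <- s) f i) = \sum_(i <- s) sf_hom F (f i).
Proof.
elim: s => [|i s IH]; first by rewrite !big_nil sf_hom0.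
by rewrite !big_cons sf_homD IH.
Qed.

Lemma sf_hom_parity (X Y : rmod S) i (f : rHom X Y) :
  injective (@sf_hom _ _ F X Y) ->
  sf_hom F f \in sa_grad (rHom (F X) (F Y)) i -> f \in sa_grad (rHom X Y) i.
Proof.
move=> Finj.
by apply: (parity_inj_mem (@sf_homD _ _ F X Y) Finj) => j g; exact: sf_hom_grad.
Qed.

(** Bijectivity is required on odd maps as well, and isomorphisms are even maps that are bijective
    as functions, so that later arguments can work with elements. *)
Definition sf_equivalence : Prop :=
  (forall X Y : rmod S, bijective (@sf_hom _ _ F X Y)) /\
  (forall Z : rmod R, exists (X : rmod S) (f : even_hom (C := sMod R) (F X) Z),
    bijective (lin (val f))).

(* An odd map X -> Y is an even map from X to the parity shift of Y, so bijectivity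
   on even morphisms propagates to odd ones. *)
Lemma module_equivalence_sf : module_equivalence F -> sf_equivalence.
Proof.
move=> /is_equivalence_ff [Fff Fes]; split; last first.
  move=> Z; have [X [f /cat_isoK [g [fK gK]]]] := Fes Z.
  by exists X, f; exists (lin (val g)).
move=> X Y.
have inj0 (Z W : rmod S) (f : rHom Z W) : f \in sa_grad (rHom Z W) false ->
    sf_hom F f = 0 -> f = 0.
  move=> f0 Ff0; apply: (congr1 val) (_ : mk_even f0 = 0).
  by apply: (bij_inj (Fff Z W)); apply: val_inj; rewrite /= sf_hom0.
have surj0 (Z W : rmod S) (h : rHom (F Z) (F W)) :
    h \in sa_grad (rHom (F Z) (F W)) false -> exists f, sf_hom F f = h.
  move=> h0; have [g _ gK] := Fff Z W.
  exists (val (g (mk_even h0))).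
  exact: (congr1 val (gK (mk_even h0))).
have FTO (W : rmod S) : rcomp (sf_hom F (of_shift W)) (sf_hom F (to_shift W)) = idfun.
  have E : @sc_comp (sMod S) _ _ _ (of_shift W) (to_shift W) = @sc_id (sMod S) W.
    exact: linear_ext.
  by rewrite -[LHS](sf_comp F) E; exact: (sf_id F).
apply: inj_surj_bij => [f g fg|h].
  apply/eqP; rewrite -subr_eq0; apply/eqP; move: (f - g) (morphDB (@sf_homD _ _ F X Y) f g).
  rewrite fg subrr => {fg g}f; rewrite {1}(rhom_part_sum f) sf_homD.
  have p0 := sf_hom_grad F (rhom_part_mem false f).
  have p1 := sf_hom_grad F (rhom_part_mem true f).
  move=> Ff.
  have F0 : sf_hom F (rhom_part false f) = 0.
    have := congr1 (gproj (sa_grad (rHom (F X) (F Y))) false) Ff.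
    by rewrite raddfD raddf0 /= (gproj_id _ p0) (gproj_id _ p1) /= addr0.
  have F1 : sf_hom F (rhom_part true f) = 0 by move: Ff; rewrite F0 add0r.
  rewrite (rhom_part_sum f) (inj0 _ _ _ (rhom_part_mem false f) F0) add0r.
  have : rcomp (to_shift Y) (rhom_part true f) = 0.
    apply: inj0; first exact: (rhom_comp_parity (to_shift_odd Y) (rhom_part_mem true f)).
    rewrite [LHS](sf_comp F) F1.
    by apply: linear_ext => x; exact: raddf0.
  by move=> E; apply: linear_ext => x; exact: (congr1 (fun h : rHom X _ => lin h x) E).
have [f0 f0E] := surj0 _ _ _ (rhom_part_mem false h).
(* The odd part of [h] becomes even after composition with the odd map [F (to_shift Y)]. By [FTO],
   [F (of_shift Y)] cancels that factor, so [of_shift Y] after [k] is sent to the odd part. *)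
have [k kE] := surj0 _ _ _ (rhom_comp_parity (sf_hom_grad F (to_shift_odd Y))
  (rhom_part_mem true h)).
exists (f0 + rcomp (of_shift Y) k); rewrite sf_homD f0E [X in _ + X](sf_comp F) kE.
rewrite [RHS](rhom_part_sum h); congr (_ + _).
rewrite -[X in _ = X](rcomp1f (rhom_part true h)) -FTO.
exact: rcompA.
Qed.

Lemma sf_module_equivalence : sf_equivalence -> module_equivalence F.
Proof.
move=> [Fff Fes]; apply: ff_is_equivalence => [X Y|Z]; last first.
  by have [X [f fb]] := Fes Z; exists X, f; exact: cat_iso_even.
apply: inj_surj_bij => [f g fg|h].
  apply: val_inj; apply: (bij_inj (Fff X Y)); exact: (congr1 val fg).
have [g _ gK] := Fff X Y.
have g0 : g (val h) \in sa_grad (rHom X Y) false.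
  by apply: (sf_hom_parity (bij_inj (Fff X Y))); rewrite gK; exact: (valP h).
by exists (mk_even g0); apply: val_inj; exact: gK.
Qed.
End ModuleEquivalence.

(** * Tensor products *)

Section SuperNatIso.
Variables (C D : supercat).
Implicit Types F G H : superfunctor C D.

Lemma super_nat_iso_sym F G : super_nat_iso F G -> super_nat_iso G F.
Proof.
move=> [eta [etaI etaN]]; pose e X := sval (cid (etaI X)).
have eK X : cat_comp (e X) (eta X) = cat_id _ /\ cat_comp (eta X) (e X) = cat_id _ :=
  svalP (cid (etaI X)).
exists e; split=> [X|X Y f]; first by exists (eta X); case: (eK X).
have eKl Z : sc_comp (val (e Z)) (val (eta Z)) = sc_id (F Z) := congr1 val (eK Z).1.
have eKr Z : sc_comp (val (eta Z)) (val (e Z)) = sc_id (G Z) := congr1 val (eK Z).2.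
rewrite -[sf_hom G f]sc_compf1 -(eKr X) (sc_compA (sf_hom G f)).
by rewrite -etaN !sc_compA eKl sc_comp1f.
Qed.

Lemma super_nat_iso_trans F G H :
  super_nat_iso F G -> super_nat_iso G H -> super_nat_iso F H.
Proof.
move=> [a [aI aN]] [b [bI bN]]; exists (fun X => cat_comp (b X) (a X)).
split=> [X|X Y f].
  have [a' [a1 a2]] := aI X; have [b' [b1 b2]] := bI X.
  exists (cat_comp a' b'); rewrite -!cat_compA; split.
    by rewrite (cat_compA b') b1 cat_comp1f.
  by rewrite (cat_compA (a X)) a2 cat_comp1f.
change (sc_comp (sc_comp (val (b Y)) (val (a Y))) (sf_hom F f) =
  sc_comp (sf_hom H f) (sc_comp (val (b X)) (val (a X)))).
by rewrite -sc_compA aN !sc_compA bN.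
Qed.
End SuperNatIso.

Lemma super_nat_iso_comp (C D E : supercat) (F F' : superfunctor C D)
    (G G' : superfunctor D E) :
  super_nat_iso F F' -> super_nat_iso G G' ->
  super_nat_iso (superfunctor_comp G F) (superfunctor_comp G' F').
Proof.
move=> [a [aI aN]] [b [bI bN]].
exists (fun X => @cat_comp (even_cat E) _ _ _ (fun_hom (even_functor G') (a X)) (b (F X))).
split=> [X|X Y f].
  have [a' [a1 a2]] := aI X; have [b' [b1 b2]] := bI (F X).
  exists (cat_comp b' (fun_hom (even_functor G') a')); split.
    rewrite -cat_compA [X in cat_comp b' X]cat_compA -(fun_comp (even_functor G')) a1 fun_id.
    by rewrite cat_comp1f.
  rewrite -cat_compA [X in cat_comp _ X]cat_compA b2 cat_comp1f.
  by rewrite -[LHS](fun_comp (even_functor G')) a2 fun_id.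
change (sc_comp (sc_comp (sf_hom G' (val (a Y))) (val (b (F Y)))) (sf_hom G (sf_hom F f)) =
  sc_comp (sf_hom G' (sf_hom F' f)) (sc_comp (sf_hom G' (val (a X))) (val (b (F X))))).
by rewrite -sc_compA bN !sc_compA -!sf_comp aN.
Qed.

Lemma super_nat_iso_mk (S R : superRing) (F G : superfunctor (sMod S) (sMod R))
    (eta : forall X : rmod S, even_hom (C := sMod R) (F X) (G X)) :
  (forall X, bijective (lin (val (eta X)))) ->
  (forall (X Y : rmod S) (f : rHom X Y) x,
    lin (val (eta Y)) (lin (sf_hom F f) x) = lin (sf_hom G f) (lin (val (eta X)) x)) ->
  super_nat_iso F G.
Proof.
move=> etaI etaN; exists eta; split=> [X|X Y f]; first exact: cat_iso_even.
by apply: linear_ext => x; exact: etaN.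
Qed.

Section TensorLift.
Variables (S R : superRing) (M : rmod S) (P : bimod S R) (X : rmod R).
Variable f : M -> P -> X.
Hypothesis fP : balanced (M := M) (N := bm_left P) f.
Hypothesis fZ : forall (r : R^c) m p, f m (r *: p) = r *: f m p.

Lemma tensor_lift_linear : linear (tlift (N := bm_left P) f : tensor M P -> X).
Proof.
move=> r t u; rewrite (tliftD fP); congr (_ + _).
move: t; apply: tens_eq => [t v|t v|m p].
- by rewrite [X in tlift _ X](scalerDr r (t : tensor M P) v); exact: (tliftD fP).
- by rewrite (tliftD fP); exact: scalerDr.
by rewrite tensor_ractE [LHS](tliftE fP) (tliftE fP) fZ.
Qed.

Definition tensor_lift : rHom (tensor M P) X :=
  (HB.pack (tlift (N := bm_left P) f : tensor M P -> X)
    (GRing.isLinear.Build R^c (tensor M P) X *:%R _ tensor_lift_linear) :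
    {linear tensor M P -> X}).

Lemma tensor_liftE m p : lin tensor_lift (tpure m (p : bm_left P)) = f m p.
Proof. exact: (tliftE fP). Qed.

Lemma tensor_lift_even :
  (forall i j m p, m \in rm_grad M i -> p \in rm_grad P j ->
    f m p \in rm_grad X (i (+) j)) ->
  tensor_lift \in sa_grad (rHom (tensor M P) X) false.
Proof.
move=> fgr; apply/rhomP => j; apply: span_ind => [|t u tP uP|_ [a b m p mM pP <-]].
- by rewrite raddf0 rpred0.
- by rewrite raddfB rpredB.
- by rewrite tensor_liftE; exact: (fgr _ _ _ _ mM pP).
Qed.
End TensorLift.

Lemma tensor_ext (S R : superRing) (M : rmod S) (P : bimod S R) (A : zmodType)
    (f g : tensor M P -> A) :
  {morph f : x y / x + y} -> {morph g : x y / x + y} ->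
  (forall m p, f (tpure m p) = g (tpure m p)) -> f =1 g.
Proof. exact: tens_eq. Qed.

Section TensorUnit.
Variables (S R : superRing) (P : bimod S R).

Lemma tensor_unit_balanced : balanced (M := rreg S) (N := bm_left P) (@lact S R P).
Proof.
split=> [p|s|s t p]; [exact: lactDl|exact: lactDr|].
by rewrite rreg_ractE -lactA.
Qed.

Definition tensor_unit : rHom (tensor (rreg S) P) P :=
  tensor_lift tensor_unit_balanced (fun r s p => lact_ract s p r).

Lemma tensor_unitE s p : lin tensor_unit (tpure (s : rreg S) (p : bm_left P)) = lact s p.
Proof. exact: tensor_liftE. Qed.

Lemma tensor_unit_even : tensor_unit \in sa_grad (rHom (tensor (rreg S) P) P) false.
Proof. by apply: tensor_lift_even => i j s p sS pP; exact: lact_grad. Qed.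

Definition tensor_unit_inv (p : P) : tensor (rreg S) P :=
  tpure ((1 : S) : rreg S) (p : bm_left P).

Lemma tensor_unitK : cancel (lin tensor_unit) tensor_unit_inv.
Proof.
apply: tensor_ext => // [x y|s p].
  by rewrite raddfD; exact: tpureDr.
rewrite tensor_unitE /tensor_unit_inv.
have := tpureM (M := rreg S) (N := bm_left P) (1 : S) s p.
by rewrite rreg_ractE mul1r => <-.
Qed.

Lemma tensor_unit_invK : cancel tensor_unit_inv (lin tensor_unit).
Proof. by move=> p; rewrite tensor_unitE lact1. Qed.

(** The left action on [P] is the functor applied to left multiplication on the regular module. This
    is how the action is recovered from the functor alone. *)
Lemma tensor_unit_lact (s : S) x :
  lin tensor_unit (tmap P (lin (ptmap (s : rreg S))) x) = lact s (lin tensor_unit x).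
Proof.
move: x; apply: tensor_ext => [x y|x y|t p].
- by rewrite !raddfD.
- by rewrite raddfD lactDr.
by rewrite tmapE !tensor_unitE lactA.
Qed.
End TensorUnit.

(** * Isomorphic bimodules and isomorphic functors *)

Section TensorIso.
Variables (S R : superRing).

Lemma bimod_iso_tensor (P Q : bimod S R) :
  bimod_iso P Q -> super_nat_iso (tensor_functor P) (tensor_functor Q).
Proof.
move=> [f [fb fl fe]]; case: (fb) => g fK gK.
have gl s x : g (lact s x) = lact s (g x) by apply: (can_inj fK); rewrite fl !gK.
have glin : linear g by move=> r x y; apply: (can_inj fK); rewrite linearP !gK.
pose F M m (p : P) : tensor M Q := tpure (m : M) (f p : bm_left Q).
pose G M m (q : Q) : tensor M P := tpure (m : M) (g q : bm_left P).
have FP M : balanced (M := M) (N := bm_left P) (@F M).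
  split=> [p|m p p'|m s p]; first exact: tpureDl.
    by rewrite /F [X in tpure _ X](raddfD f p p'); exact: tpureDr.
  by rewrite /F [X in _ = tpure _ X](fl s p); exact: tpureM.
have GP M : balanced (M := M) (N := bm_left Q) (@G M).
  split=> [p|m p p'|m s p]; first exact: tpureDl.
    rewrite /G; have -> : g (p + p') = g p + g p'.
      by have := glin 1 p p'; rewrite !scale1r.
    exact: tpureDr.
  by rewrite /G [X in _ = tpure _ X](gl s p); exact: tpureM.
have FZ M (r : R^c) m p : @F M m (r *: p) = r *: F M m p.
  by rewrite /F linearZ tensor_ractE.
have Feven M : tensor_lift (FP M) (@FZ M) \in
    sa_grad (rHom (tensor M P) (tensor M Q)) false.
  apply: tensor_lift_even => i j m p mM pP; apply: mem_tens_part => //.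
  exact: (fe _ _ pP).
apply: (@super_nat_iso_mk _ _ (tensor_functor P) (tensor_functor Q)
  (fun M => mk_even (Feven M))) => [M|M N h].
  exists (tlift (N := bm_left Q) (@G M)).
    apply: tensor_ext => // [x y|m p]; first by rewrite raddfD (tliftD (GP M)).
    by rewrite tensor_liftE (tliftE (GP M)) /G fK.
  apply: tensor_ext => // [x y|m p]; first by rewrite (tliftD (GP M)) raddfD.
  by rewrite (tliftE (GP M)) tensor_liftE /F gK.
apply: tensor_ext => [x y|x y|m p]; rewrite ?raddfD //.
change (lin (tensor_lift (FP N) (@FZ N)) (tmap P (lin h) (tpure m p)) =
  tmap Q (lin h) (lin (tensor_lift (FP M) (@FZ M)) (tpure m p))).
rewrite [X in tensor_lift _ _ X]tmapE [LHS]tensor_liftE.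
by rewrite [X in tmap Q _ X]tensor_liftE [RHS]tmapE.
Qed.

(** The component at the regular module is the required map. Its left linearity is naturality at
    [ptmap s], for odd [s] too, which is why [super_nat_iso] includes odd morphisms. *)
Lemma tensor_bimod_iso (P Q : bimod S R) :
  super_nat_iso (tensor_functor P) (tensor_functor Q) -> bimod_iso P Q.
Proof.
move=> [eta [etaI etaN]].
have [g [gK Kg]] := cat_isoK (etaI (rreg S)).
pose e := lin (val (eta (rreg S))).
pose f (p : P) : Q := lin (tensor_unit Q) (e (tensor_unit_inv p)).
have fE x : f (lin (tensor_unit P) x) = lin (tensor_unit Q) (e x).
  by rewrite /f tensor_unitK.
have fl : linear f.
  move=> r x y; rewrite -(tensor_unit_invK x) -(tensor_unit_invK y) -linearP !fE.
  by rewrite !linearP.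
pose f' : {linear P -> Q} := HB.pack f (GRing.isLinear.Build R^c P Q *:%R _ fl).
exists f'; split.
- exists (fun q => lin (tensor_unit P) (lin (val g) (tensor_unit_inv q))) => [p|q].
    rewrite -[RHS](tensor_unit_invK p) -[in RHS](gK (tensor_unit_inv p)).
    congr (lin (tensor_unit P) (lin (val g) _)); exact: tensor_unitK.
  rewrite -[RHS](tensor_unit_invK q) -[in RHS](Kg (tensor_unit_inv q)); exact: fE.
- move=> s x /=; rewrite -(tensor_unit_invK x) -tensor_unit_lact !fE -tensor_unit_lact.
  congr (lin (tensor_unit Q) _).
  exact: (congr1 (fun h : rHom (tensor (rreg S) P) (tensor (rreg S) Q) =>
    lin h (tensor_unit_inv x)) (etaN _ _ (ptmap (s : rreg S)))).
- move=> j p pP; have /rhomP uP := tensor_unit_even Q; apply: (uP).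
  have /rhomP eP := valP (eta (rreg S)); apply: (eP).
  by have := mem_tens_part (M := rreg S) (N := bm_left P) (sr_grad1 S) pP.
Qed.
End TensorIso.

(** * Associativity of the tensor product *)

Section TensorAssoc.
Variables (S R T : superRing) (P : bimod S R) (P' : bimod R T).

Section AtModule.
Variable M : rmod S.

Lemma tens_pt_linear (m : M) : linear (fun p : P => tpure m (p : bm_left P) : tensor M P).
Proof. by move=> r p q; rewrite [LHS]tpureDr tensor_ractE. Qed.

Definition tens_pt (m : M) : rHom P (tensor M P) :=
  (HB.pack (fun p : P => tpure m (p : bm_left P) : tensor M P)
    (GRing.isLinear.Build R^c P (tensor M P) *:%R _ (tens_pt_linear m)) :
    {linear P -> tensor M P}).

Lemma tens_pt_parity i m : m \in rm_grad M i ->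
  tens_pt m \in sa_grad (rHom P (tensor M P)) i.
Proof. by move=> mM; apply/rhomP => j p pP; exact: mem_tens_part. Qed.

Let PP := tensor_bimod P P'.
(** For fixed [m], the map [p |-> m (x) p] is right linear with the parity of [m]. Tensoring it with
    [P'] supplies linearity and parity in [y] at once. *)
Definition assoc_fun (m : M) (y : PP) : tensor (tensor M P) P' :=
  tmap P' (lin (tens_pt m)) y.

Lemma assoc_balanced : balanced (M := M) (N := bm_left PP) assoc_fun.
Proof.
rewrite /assoc_fun; split=> [y m m'|m y y'|m s y]; last first.
- move: y; apply: tensor_ext => [x y|x y|p p'].
  + by rewrite raddfD.
  + by rewrite [s *: _](tens_lactDr (M := P) (P := P') s x y) raddfD.
  change (tmap P' (lin (tens_pt ((s : S^c) *: m))) (tpure p p') =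
    tmap P' (lin (tens_pt m)) (tens_lact s (tpure p p'))).
  rewrite tens_lactE !tmapE; congr tpure; exact: tpureM.
- by rewrite [LHS]raddfD.
move: y; apply: tensor_ext => [x y|x y|p p'].
- by rewrite raddfD.
- by rewrite !raddfD /= addrACA.
rewrite !tmapE /= -tpureDl; congr tpure; exact: tpureDl.
Qed.

Lemma assocZ (r : T^c) m y : assoc_fun m (r *: y) = r *: assoc_fun m y.
Proof. exact: linearZ. Qed.

Definition assoc : rHom (tensor M PP) (tensor (tensor M P) P') :=
  tensor_lift assoc_balanced assocZ.

Lemma assocE m (p : P) (p' : bm_left P') : lin assoc (tpure m (tpure p p' : bm_left PP)) =
  tpure (tpure m (p : bm_left P) : tensor M P) (p' : bm_left P').
Proof. by rewrite tensor_liftE /assoc_fun tmapE. Qed.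

Lemma assoc_even : assoc \in sa_grad (rHom _ _) false.
Proof.
apply: tensor_lift_even => i j m y mM yP.
by have /rhomP := tmap_parity P' (tens_pt_parity mM); apply.
Qed.

Definition unassoc_in (p' : bm_left P') (m : M) (p : bm_left P) : tensor M PP :=
  tpure m (tpure p p' : bm_left PP).

Lemma unassoc_in_balanced p' : balanced (M := M) (N := bm_left P) (unassoc_in p').
Proof.
rewrite /unassoc_in; split=> [p m m'|m p q|m s p]; first exact: tpureDl.
  by rewrite (tpureDl (M := P)); exact: tpureDr.
have -> : tpure (lact s p : P) p' = tens_lact s (tpure (p : P) p') :> tensor P P'.
  by rewrite tens_lactE.
exact: tpureM.
Qed.

(** The inverse is lifted one tensor sign at a time: first over [M (x) P] with [p'] fixed, then over
    the outer product. *)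
Definition unassoc_out (x : tensor M P) (p' : bm_left P') : tensor M PP :=
  tlift (unassoc_in p') x.

Lemma unassoc_balanced : balanced (M := tensor M P) (N := bm_left P') unassoc_out.
Proof.
rewrite /unassoc_out; split=> [p' x y|x p' q'|x r p'].
- by rewrite (tliftD (unassoc_in_balanced p')).
- move: x; apply: tensor_ext => [x y|x y|m p].
  + by rewrite (tliftD (unassoc_in_balanced _)).
  + by rewrite !(tliftD (unassoc_in_balanced _)) addrACA.
  rewrite !(tliftE (unassoc_in_balanced _)) /unassoc_in (tpureDr (M := P)).
  exact: tpureDr.
move: x; apply: tensor_ext => [x y|x y|m p].
- by rewrite scalerDr (tliftD (unassoc_in_balanced _)).
- by rewrite (tliftD (unassoc_in_balanced _)).
rewrite tensor_ractE !(tliftE (unassoc_in_balanced _)) /unassoc_in.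
by congr tpure; exact: tpureM.
Qed.

Lemma assoc_bij : bijective (lin assoc).
Proof.
exists (tlift (N := bm_left P') unassoc_out).
  apply: tensor_ext => // [x y|m]; first by rewrite raddfD (tliftD unassoc_balanced).
  apply: tensor_ext => [x y|x y|p p'].
  - rewrite [X in lin assoc X](tpureDr (M := M)) raddfD (tliftD unassoc_balanced) //.
  - exact: tpureDr.
  rewrite assocE (tliftE unassoc_balanced) /unassoc_out.
  by rewrite (tliftE (unassoc_in_balanced _)).
apply: tensor_ext => // [x y|x p']; first by rewrite (tliftD unassoc_balanced) raddfD.
rewrite (tliftE unassoc_balanced) /unassoc_out.
move: x; apply: tensor_ext => [x y|x y|m p].
- by rewrite (tliftD (unassoc_in_balanced _)) raddfD.
- exact: (tpureDl (M := tensor M P)).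
by rewrite (tliftE (unassoc_in_balanced _)) /unassoc_in assocE.
Qed.
End AtModule.

Lemma tensor_assoc_iso : super_nat_iso (tensor_functor (tensor_bimod P P'))
  (superfunctor_comp (tensor_functor P') (tensor_functor P)).
Proof.
apply: (@super_nat_iso_mk _ _ (tensor_functor (tensor_bimod P P'))
  (superfunctor_comp (tensor_functor P') (tensor_functor P))
  (fun M => mk_even (assoc_even M))) => [M|M N f].
  exact: assoc_bij.
apply: tensor_ext => [x y|x y|m]; rewrite ?raddfD //.
apply: tensor_ext => [x y|x y|p p'].
- by rewrite (tpureDr (M := M)) !raddfD.
- by rewrite (tpureDr (M := M)) !raddfD.
pose y : bm_left (tensor_bimod P P') := tpure p p'.
change (lin (assoc N) (tmap (tensor_bimod P P') (lin f) (tpure m y)) =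
  tmap P' (tmap P (lin f)) (lin (assoc M) (tpure m y))).
rewrite [X in assoc _ X]tmapE !assocE [RHS]tmapE.
exact: (congr1 (fun z : tensor N P => tpure z p') (esym (tmapE (lin f) m p))).
Qed.
End TensorAssoc.

(** * Tensoring with a progenerator *)

Section HomModule.
Variables (S R : superRing) (P : bimod S R) (X : rmod R).

Definition hommod_car : Type := {linear P -> X}.
HB.instance Definition _ := GRing.Zmodule.on hommod_car.

Definition hommod_scale (s : S^c) (h : hommod_car) : hommod_car :=
  rcomp (h : rHom P X) (left_mul P s).

Lemma hommod_scaleA s t h : hommod_scale s (hommod_scale t h) = hommod_scale (s * t) h.
Proof. by apply: linear_ext => p /=; rewrite lactA. Qed.
Lemma hommod_scale1 : left_id 1 hommod_scale.
Proof. by move=> h; apply: linear_ext => p /=; rewrite lact1. Qed.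
Lemma hommod_scaleDr : right_distributive hommod_scale +%R.
Proof. by move=> s h k; apply: linear_ext. Qed.
Lemma hommod_scaleDl h : {morph hommod_scale^~ h : s t / s + t}.
Proof. by move=> s t; apply: linear_ext => p /=; rewrite lactDl raddfD. Qed.
HB.instance Definition _ := GRing.Zmodule_isLmodule.Build S^c hommod_car
  hommod_scaleA hommod_scale1 hommod_scaleDr hommod_scaleDl.

Lemma hommod_gradM i j (h : hommod_car) (s : S) :
  h \in sa_grad (rHom P X) i -> s \in sr_grad S j ->
  (s : S^c) *: h \in sa_grad (rHom P X) (i (+) j).
Proof. by move=> hi sj; apply: rhom_comp_parity => //; exact: left_mul_parity. Qed.

Definition hommod : rmod S := @Rmod S hommod_car (sa_grad (rHom P X)) hommod_gradM.

Definition ev_fun (h : hommod) (p : P) : X := lin h p.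

Lemma ev_balanced : balanced (M := hommod) (N := bm_left P) ev_fun.
Proof. by split=> // h p q; exact: raddfD. Qed.

Lemma ev_ract (r : R^c) (h : hommod) p : ev_fun h (r *: p) = r *: ev_fun h p.
Proof. exact: linearZ. Qed.

(** The counit of the adjunction between [- (x)_S P] and [hommod P]. *)
Definition ev : rHom (tensor hommod P) X := tensor_lift ev_balanced ev_ract.

Lemma ev_even : ev \in sa_grad (rHom (tensor hommod P) X) false.
Proof. by apply: tensor_lift_even => i j h p /rhomP hP pP; exact: hP. Qed.
End HomModule.

Section TensorSum.
Variables (S R : superRing) (M : rmod S) (P : bimod S R) (I : Type) (s : seq I).

Lemma tpure_suml (f : I -> M) (p : bm_left P) :
  tpure (\sum_(i <- s) f i) p = \sum_(i <- s) tpure (f i) p.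
Proof. exact: (big_morph (fun m : M => tpure m p) (tpureDl p) (morphD0 (tpureDl p))). Qed.

Lemma tpure_sumr (m : M) (f : I -> P) :
  tpure m (\sum_(i <- s) f i : bm_left P) = \sum_(i <- s) tpure m (f i : bm_left P).
Proof.
elim: s => [|i s' IH]; first by rewrite !big_nil (morphD0 (tpureDr m)).
by rewrite !big_cons -IH; exact: tpureDr.
Qed.
End TensorSum.

Section TensorEquivalence.
Variables (S R : superRing) (P : bimod S R).
Hypothesis P_end : bijective (@left_mul S R P).

Definition end_inv (f : rEnd P) : S := sval (cid (let: Bijective g _ gK := P_end in
  ex_intro (fun s => left_mul P s = f) (g f) (gK f))).

Lemma end_invK f : left_mul P (end_inv f) = f.
Proof. by rewrite /end_inv; case: cid. Qed.

Lemma lact_inj s t : (forall x, lact (b := P) s x = lact t x) -> s = t.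
Proof. by move=> st; apply: (bij_inj P_end); exact: linear_ext. Qed.

Implicit Types (p x : P) (g : rHom P (rreg R)).

(* The element of S acting on P as x |-> p (g x). *)
Definition rank1 p g : S := end_inv (rcomp (ptmap p) g).

Lemma rank1E p g x : lact (rank1 p g) x = (lin g x : R^c) *: p.
Proof.
exact: (congr1 (fun f : {linear P -> P} => f x) (end_invK (rcomp (ptmap p) g))).
Qed.

Lemma rank1D g : {morph rank1^~ g : p q / p + q}.
Proof. by move=> p q; apply: lact_inj => x; rewrite lactDl !rank1E scalerDr. Qed.

Lemma rank1_lact s p g : rank1 (lact s p) g = s * rank1 p g.
Proof. by apply: lact_inj => x; rewrite -lactA !rank1E lact_ract. Qed.

Section Tau.
Variables (M : rmod S) (g : rHom P (rreg R)).

Definition tau_fun (m : M) (p : bm_left P) : M := (rank1 p g : S^c) *: m.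

Lemma tau_balanced : balanced tau_fun.
Proof.
rewrite /tau_fun; split=> [p m m'|m p q|m s p]; first exact: scalerDr.
  by rewrite [rank1 _ _]rank1D scalerDl.
by rewrite scalerA [rank1 (s *: p) _]rank1_lact.
Qed.

(** Contraction of the second factor against the functional [g]. It can land in [M] because every
    rank one endomorphism of [P] comes from [S]. *)
Definition tau : tensor M P -> M := tlift tau_fun.

Lemma tauE m p : tau (tpure m (p : bm_left P)) = (rank1 p g : S^c) *: m.
Proof. exact: (tliftE tau_balanced). Qed.

Lemma tauD : {morph tau : x y / x + y}.
Proof. exact: (tliftD tau_balanced). Qed.

Lemma tpure_tau (y : tensor M P) p :
  tpure (tau y) (p : bm_left P) = (lin g p : R^c) *: y :> tensor M P.
Proof.
move: y; apply: tensor_ext => [x y|x y|m q].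
- by rewrite tauD; exact: tpureDl.
- by rewrite scalerDr.
rewrite tauE tensor_ractE -(rank1E q g p); exact: tpureM.
Qed.
End Tau.

Section Faithful.
Variable s : seq (P * rHom P (rreg R)).
Hypothesis sP : dual_basis s.
Variables M N : rmod S.

(** The dual basis identity says that the sum of the [rank1 u.1 u.2] acts on [P] as the identity;
    since [S] acts faithfully, this sum is 1 in [S]. *)
Lemma tau_dual_basis (m : M) : m = \sum_(u <- s) tau u.2 (tpure m (u.1 : bm_left P)).
Proof.
have E : \sum_(u <- s) rank1 u.1 u.2 = 1.
  apply: lact_inj => x; rewrite lact1 {2}(sP x).
  rewrite (big_morph (fun t => lact t x) (lactDl x) (morphD0 (lactDl x))).
  by apply: eq_bigr => u _; rewrite rank1E.
rewrite -[LHS]scale1r -[1]E scaler_suml.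
by apply: eq_bigr => u _; rewrite tauE.
Qed.

Lemma tpure_inj (m n : M) :
  (forall p, tpure m (p : bm_left P) = tpure n (p : bm_left P)) -> m = n.
Proof.
move=> mn; rewrite (tau_dual_basis m) (tau_dual_basis n).
by apply: eq_bigr => u _; rewrite mn.
Qed.
End Faithful.

Lemma tensor_ff (s : seq (P * rHom P (rreg R))) (M N : rmod S) : dual_basis s ->
  bijective (@sf_hom _ _ (tensor_functor P) M N).
Proof.
move=> sP; apply: inj_surj_bij => [f f' ff'|h].
  apply: linear_ext => m; apply: (tpure_inj sP) => p.
  have E := congr1 (fun f : {linear tensor M P -> tensor N P} =>
    f (tpure m (p : bm_left P))) ff'.
  exact: etrans (esym (tmapE (lin f) m p)) (etrans E (tmapE (lin f') m p)).
(* If [h] is [k (x) P], then [h] sends [m (x) u.1] to [k m (x) u.1], and [tau_dual_basis] forces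
   this formula for [k m]. *)
pose k m := \sum_(u <- s) tau u.2 (lin h (tpure m (u.1 : bm_left P))).
have kE m p : tpure (k m) (p : bm_left P) = lin h (tpure m (p : bm_left P)).
  rewrite /k tpure_suml {2}(sP p) tpure_sumr.
  rewrite raddf_sum; apply: eq_bigr => u _.
  by rewrite tpure_tau -linearZ tensor_ractE.
have kl : linear k.
  move=> r m m'; apply: (tpure_inj sP) => p.
  by rewrite kE !tpureDl !tpureM !kE raddfD; congr (_ + _).
pose k' : {linear M -> N} := HB.pack k (GRing.isLinear.Build S^c M N *:%R _ kl).
exists k'; apply: tmap_eq => m p; rewrite [LHS]tmapE; exact: kE.
Qed.

Lemma tensor_es (t : seq (rHom P (rreg R) * P)) :
  (1 : R) = \sum_(u <- t) (lin u.1 u.2 : rreg R) ->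
  forall X : rmod R, exists (M : rmod S) (f : even_hom (C := sMod R) (tensor M P) X),
    bijective (lin (val f)).
Proof.
move=> tP X; exists (hommod P X), (mk_even (ev_even P X)).
have ractE (Y : rmod R) (x : Y) : x = \sum_(u <- t) (lin u.1 u.2 : R^c) *: x.
  by rewrite -scaler_suml -[X in X *: _]tP scale1r.
pose inv (x : X) : tensor (hommod P X) P :=
  \sum_(u <- t) tpure (rcomp (ptmap x) u.1 : hommod P X) (u.2 : bm_left P).
have invD : {morph inv : x y / x + y}.
  move=> x y; rewrite /inv -big_split; apply: eq_bigr => u _ /=.
  rewrite -tpureDl; congr tpure; rewrite ptmapD; exact: rcompDl.
exists inv => [y|x]; last first.
  rewrite raddf_sum [RHS]ractE; apply: eq_bigr => u _.
  by rewrite [LHS]tensor_liftE.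
move: y; apply: tensor_ext => [y z|y z|h p] //; first by rewrite raddfD invD.
(* For a trace pair [(g, q)], [h (x) p g(q) = h (x) [p g] q = h [p g] (x) q], and [h [p g]] is the
   map [x |-> h(p) g(x)] that occurs in [inv (h p)]. *)
rewrite [X in inv X]tensor_liftE /inv [in RHS](ractE _ p).
rewrite tpure_sumr.
apply: eq_bigr => u _; rewrite -rank1E.
transitivity (tpure ((rank1 p u.1 : S^c) *: h) (u.2 : bm_left P)); last exact: tpureM.
congr tpure; apply: linear_ext => x.
by change ((lin u.1 x : R^c) *: lin h p = lin h (lact (rank1 p u.1) x)); rewrite rank1E linearZ.
Qed.
End TensorEquivalence.

Lemma progenerator_equivalence (S R : superRing) (P : bimod S R) :
  bimod_progenerator P -> sf_equivalence (tensor_functor P).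
Proof.
move=> [[[_ _ P_end _] _] [Pfg Pproj Pgen]].
have [s sP] := fg_projective_dual_basis Pfg Pproj.
have [t tP] := generator_trace Pgen.
split=> [M N|X]; first exact: (tensor_ff P_end _ _ sP).
exact: (tensor_es P_end tP X).
Qed.

(** * The bimodule of an equivalence *)

Section EvenIso.
Variables (R : superRing) (P Q : rmod R) (f : even_hom (C := sMod R) P Q).
Hypothesis f_bij : bijective (lin (val f)).

Lemma even_iso_inv : exists g : rHom Q P,
  cancel (lin (val f)) (lin g) /\ cancel (lin g) (lin (val f)).
Proof. by have [g gK] := cat_isoK (cat_iso_even f_bij); exists (val g). Qed.

Lemma generator_even_iso : @generator R P -> @generator R Q.
Proof.
have [g [fK gK]] := even_iso_inv => P_gen M N h h0; apply: P_gen => k.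
apply: linear_ext => x.
have := congr1 (fun u : rHom Q N => lin u (lin (val f) x)) (h0 (rcomp k g)).
by rewrite /= fK.
Qed.

Lemma dual_basis_even_iso (s : seq (P * rHom P (rreg R))) : dual_basis s ->
  exists s' : seq (Q * rHom Q (rreg R)), dual_basis s'.
Proof.
have [g [fK gK]] := even_iso_inv => sP.
exists [seq (lin (val f) u.1, rcomp u.2 g) | u <- s] => x.
rewrite big_map -{1}(gK x) {1}(sP (lin g x)) raddf_sum.
by apply: eq_bigr => u _; exact: linearZ.
Qed.
End EvenIso.

Section FromEquivalence.
Variables (S R : superRing) (F : superfunctor (sMod S) (sMod R)).

Lemma sf_compE (L M N : rmod S) (g : rHom M N) (f : rHom L M) x :
  lin (sf_hom F (rcomp g f)) x = lin (sf_hom F g) (lin (sf_hom F f) x).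
Proof. by rewrite [sf_hom F _](sf_comp F). Qed.

Let P0 : rmod R := F (rreg S).

Definition image_lact (s : S) : P0 -> P0 := lin (sf_hom F (ptmap (s : rreg S))).

Lemma image_lactA s t x : image_lact s (image_lact t x) = image_lact (s * t) x.
Proof.
rewrite /image_lact -sf_compE; congr (lin (sf_hom F _) x).
by apply: linear_ext => u; rewrite /= !rreg_ractE mulrA.
Qed.

Lemma image_lact1 x : image_lact 1 x = x.
Proof.
rewrite /image_lact; have -> : ptmap ((1 : S) : rreg S) = @sc_id (sMod S) (rreg S).
  by apply: linear_ext => u; rewrite /= rreg_ractE mul1r.
by rewrite (sf_id F).
Qed.

Lemma image_lactDr s : {morph image_lact s : x y / x + y}.
Proof. by move=> x y; exact: raddfD. Qed.

Lemma image_lactDl x : {morph image_lact ^~ x : s t / s + t}.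
Proof. by move=> s t; rewrite /image_lact ptmapD sf_homD. Qed.

Lemma image_lact_ract s x (r : R) :
  image_lact s ((r : R^c) *: x) = (r : R^c) *: image_lact s x.
Proof. exact: linearZ_LR. Qed.

Lemma image_lact_grad i j s x : s \in sr_grad S i -> x \in rm_grad P0 j ->
  image_lact s x \in rm_grad P0 (i (+) j).
Proof.
by move=> sS; have /rhomP := sf_hom_grad F (ptmap_parity (M := rreg S) sS); apply.
Qed.

Definition image_bimod : bimod S R :=
  Bimod image_lactA image_lact1 image_lactDr image_lactDl image_lact_ract
    image_lact_grad.

Hypothesis F_ff : forall X Y : rmod S, bijective (@sf_hom _ _ F X Y).
Hypothesis F_es : forall Z : rmod R, exists (X : rmod S)
  (f : even_hom (C := sMod R) (F X) Z), bijective (lin (val f)).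

Let F_inj (X Y : rmod S) : injective (@sf_hom _ _ F X Y) := bij_inj (F_ff X Y).
Let F_surj (X Y : rmod S) (h : rHom (F X) (F Y)) : exists f : rHom X Y, sf_hom F f = h.
Proof. by have [g _ gK] := F_ff X Y; exists (g h). Qed.

(** Up to isomorphism [f] is [F f']. The hypothesis applied to [F (ptmap m)], with faithfulness,
    kills [f'] after [ptmap m], whose value at 1 is [f' m]. *)
Lemma image_generator : @generator R P0.
Proof.
move=> M N f f0; have [M' [a ab]] := F_es M; have [N' [b bb]] := F_es N.
have [a' [aK a'K]] := even_iso_inv ab; have [b' [bK b'K]] := even_iso_inv bb.
have [f' f'E] := F_surj (rcomp b' (rcomp (val f) (val a))).
have f'0 : f' = 0.
  apply: linear_ext => m.
  have E : rcomp f' (ptmap m) = 0.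
    apply: F_inj; apply: linear_ext => x; rewrite sf_compE f'E sf_hom0.
    have := congr1 (fun u : rHom P0 N => lin u x)
      (f0 (rcomp (val a) (sf_hom F (ptmap m)))).
    move=> /= ->; exact: raddf0.
  have := congr1 (fun u : rHom (rreg S) N' => lin u (1 : S)) E.
  by rewrite /= scale1r.
apply: even_hom_eq => x; rewrite -[x]a'K -[LHS]b'K.
have := congr1 (fun u : rHom (F M') (F N') => lin u (lin a' x)) f'E.
by rewrite f'0 sf_hom0 /= => <-; exact: raddf0.
Qed.

Lemma image_dual_basis : exists s : seq (P0 * rHom P0 (rreg R)), dual_basis s.
Proof.
have [Y [e eb]] := F_es (rreg R); have [e' [eK e'K]] := even_iso_inv eb.
pose one : rreg R := (1 : R).
(* An element [y] of [F(M)] is the value at [e' 1] of [ptmap y] after [e], a map from [F(Y)] and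
   hence some [F h]. So [f] after [h] being zero makes [F f] vanish at [y]. *)
have Y_gen : @generator S Y.
  move=> M N f f0; apply: val_inj; apply: F_inj; apply: linear_ext => y.
  have [h hE] := F_surj (rcomp (ptmap y) (val e)).
  have := congr1 (fun u : rHom Y N => lin (sf_hom F u) (lin e' one)) (f0 h).
  rewrite sf_compE hE !sf_hom0.
  by change (lin (sf_hom F (val f)) (ptmap y (lin (val e) (lin e' one))) = 0 ->
    lin (sf_hom F (val f)) y = 0); rewrite e'K ptmap1.
have [t tS] := generator_trace Y_gen.
(* The trace relation factors the identity of [S] as a sum of maps through [Y]. Under [F] it becomes
   a factorization of the identity of [F(S)] through [F(Y)], that is through [R]: the incoming maps
   are the functionals, the outgoing ones give the vectors. *)
have tid : @sc_id (sMod S) (rreg S) = \sum_(u <- t) rcomp u.1 (ptmap u.2).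
  apply: linear_ext => s; rewrite rhom_sumE.
  transitivity ((s : S^c) *: ((1 : S) : rreg S)); first by rewrite rreg_ractE mul1r.
  rewrite tS scaler_sumr; apply: eq_bigr => u _.
  by rewrite /= linearZ.
exists [seq (lin (sf_hom F u.1) (lin e' one), rcomp (val e) (sf_hom F (ptmap u.2))) | u <- t].
move=> x; rewrite big_map.
have E : lin (sf_hom F (@sc_id (sMod S) (rreg S))) x = x by rewrite (sf_id F).
rewrite -[LHS]E tid sf_hom_sum rhom_sumE; apply: eq_bigr => u _; rewrite sf_compE /=.
rewrite -linearZ -linearZ; congr (lin (sf_hom F u.1) _).
by rewrite -[LHS]eK; congr (lin e' _); rewrite rreg_ractE mul1r.
Qed.

Section Theta.
Variable t : seq (rHom P0 (rreg R) * P0).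
Hypothesis tP : (1 : R) = \sum_(u <- t) (lin u.1 u.2 : rreg R).
Variable M : rmod S.

Definition theta_fun (m : M) (p : image_bimod) : F M := lin (sf_hom F (ptmap m)) p.

Lemma theta_balanced : balanced (M := M) (N := bm_left image_bimod) theta_fun.
Proof.
rewrite /theta_fun; split=> [p m m'|m p p'|m s p].
- by rewrite ptmapD sf_homD.
- exact: raddfD.
rewrite -[s *: p]/(image_lact s p) /image_lact -sf_compE; congr (lin (sf_hom F _) p).
by apply: linear_ext => u; rewrite /= scalerA.
Qed.

Lemma theta_ract (r : R^c) m p : theta_fun m (r *: p) = r *: theta_fun m p.
Proof. exact: linearZ. Qed.

Definition theta : rHom (tensor M image_bimod) (F M) :=
  tensor_lift theta_balanced theta_ract.

Lemma theta_even : theta \in sa_grad (rHom (tensor M image_bimod) (F M)) false.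
Proof.
apply: tensor_lift_even => i j m p mM pP.
by have /rhomP := sf_hom_grad F (ptmap_parity mM); apply.
Qed.

Lemma theta_bij : bijective (lin theta).
Proof.
have ractE (Y : rmod R) (x : Y) : x = \sum_(u <- t) (lin u.1 u.2 : R^c) *: x.
  by rewrite -scaler_suml -[X in X *: _]tP scale1r.
(* A map from [S] to [M] is determined by its value at 1, so the preimage under [F] of the rank one
   map is recorded as an element of [M]. *)
pose pre (x : F M) (u : rHom P0 (rreg R)) : M :=
  lin (sval (cid (F_surj (rcomp (ptmap x) u)))) ((1 : S) : rreg S).
have preE x u : sf_hom F (ptmap (pre x u)) = rcomp (ptmap x) u.
  by rewrite /pre; case: cid => h /= hE; rewrite -ptmap_eq.
have ptmap_inj (m n : M) : sf_hom F (ptmap m) = sf_hom F (ptmap n) -> m = n.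
  by move=> /F_inj E; rewrite -(ptmap1 m) -(ptmap1 n) E.
have preD u : {morph pre^~ u : x y / x + y}.
  move=> x y; apply: ptmap_inj; rewrite ptmapD sf_homD !preE ptmapD; exact: rcompDl.
pose inv (x : F M) : tensor M image_bimod :=
  \sum_(u <- t) tpure (pre x u.1) (u.2 : bm_left image_bimod).
have invD : {morph inv : x y / x + y}.
  move=> x y; rewrite /inv -big_split; apply: eq_bigr => u _ /=.
  by rewrite preD tpureDl.
exists inv => [y|x]; last first.
  rewrite raddf_sum [RHS]ractE; apply: eq_bigr => u _.
  by rewrite [LHS]tensor_liftE /theta_fun preE.
move: y; apply: tensor_ext => [y z|y z|m p] //; first by rewrite raddfD invD.
rewrite [X in inv X]tensor_liftE /inv [in RHS](ractE image_bimod p) tpure_sumr.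
apply: eq_bigr => u _.
(* Fullness plays here the part of the double centralizer: the rank one endomorphism of [F(S)] is
   [F] of left multiplication by [s = h 1], so it can be moved across the tensor sign. *)
have [h hE] := F_surj (rcomp (ptmap (p : P0)) u.1).
pose s : S := lin h ((1 : S) : rreg S).
have hs : h = ptmap (s : rreg S) := ptmap_eq h.
transitivity (tpure ((s : S^c) *: m) (u.2 : bm_left image_bimod)).
  congr tpure; apply: ptmap_inj; rewrite preE.
  have -> : ptmap ((s : S^c) *: m) = rcomp (ptmap m) (ptmap (s : rreg S)).
    by apply: linear_ext => v; rewrite /= scalerA.
  apply: linear_ext => x; rewrite sf_compE -hs hE.
  by rewrite /= -linearZ.
rewrite tpureM; congr tpure.
change (image_lact s u.2 = (lin u.1 u.2 : R^c) *: p).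
by rewrite /image_lact -hs hE.
Qed.
End Theta.

Lemma image_tensor_iso : super_nat_iso F (tensor_functor image_bimod).
Proof.
apply: super_nat_iso_sym; have [t tP] := generator_trace image_generator.
apply: (@super_nat_iso_mk _ _ (tensor_functor image_bimod) F
  (fun M => mk_even (theta_even M))) => [M|M N f]; first exact: theta_bij tP M.
apply: tensor_ext => [x y|x y|m p]; rewrite ?raddfD //.
change (lin (theta N) (tmap image_bimod (lin f) (tpure m p)) =
  lin (sf_hom F f) (lin (theta M) (tpure m p))).
rewrite [X in theta _ X]tmapE [LHS]tensor_liftE [X in sf_hom F f X]tensor_liftE.
rewrite /theta_fun -sf_compE; congr (lin (sf_hom F _) p).
by apply: linear_ext => s; rewrite /= linearZ.
Qed.

Section Balanced.
Variables (P : bimod S R) (phi : even_hom (C := sMod R) P0 P).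
Hypothesis phi_bij : bijective (lin (val phi)).
Hypothesis phi_lact : forall s x,
  lin (val phi) (image_lact s x) = lact s (lin (val phi) x).

(** Full faithfulness identifies the endomorphisms of [F(S)] with those of the regular module, which
    are the left multiplications. Transport along [phi] extends this to every bimodule isomorphic to
    the image bimodule. *)
Lemma left_mul_bij : bijective (@left_mul S R P).
Proof.
have [psi [phiK psiK]] := even_iso_inv phi_bij.
apply: inj_surj_bij => [s t st|f].
  suff : ptmap (s : rreg S) = ptmap (t : rreg S).
    move=> E; rewrite -[s](ptmap1 (s : rreg S)) -[t](ptmap1 (t : rreg S)).
    by rewrite E.
  apply: F_inj; apply: linear_ext => x; apply: (can_inj phiK).
  rewrite [LHS]phi_lact [RHS]phi_lact.
  exact: (congr1 (fun f : {linear P -> P} => f (lin (val phi) x)) st).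
have [h hE] := F_surj (rcomp psi (rcomp f (val phi))).
exists (lin h ((1 : S) : rreg S) : S); apply: linear_ext => p.
rewrite /= -{1}(psiK p) -phi_lact /image_lact -ptmap_eq hE /=.
by rewrite !psiK.
Qed.
End Balanced.
End FromEquivalence.

(** * The double centralizer *)

Section DoubleCentralizer.
Variables (S R : superRing) (P : bimod S R).
Local Notation D := (rm_grad P).

Lemma left_mulD : {morph @left_mul S R P : s t / s + t}.
Proof. by move=> s t; apply: linear_ext => x; exact: lactDl. Qed.

Lemma left_mul_iso : bijective (@left_mul S R P) -> super_ring_iso (@left_mul S R P).
Proof.
move=> lb; split=> //; [exact: (morphDB left_mulD)|split|exact: left_mul_parity].
  by apply: linear_ext => x; exact: lact1.
by move=> s t; apply: linear_ext => x; rewrite /= lactA.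
Qed.

Lemma right_mulE i j (b : R) (x : P) : b \in sr_grad R i -> x \in D j ->
  right_mul P b x = ksgn i j ((b : R^c) *: x).
Proof. exact: right_mul_funE. Qed.

Lemma right_mulD : {morph @right_mul S R P : b c / b + c}.
Proof. by move=> b c; apply: lhom_ext => x; exact: right_mul_funDl. Qed.

Lemma right_mul_grad i b : b \in sr_grad R i ->
  right_mul P b \in sr_grad (sopp (lEnd (bm_left P))) i.
Proof. by move=> bR; apply/asboolP; exact: right_mul_homog. Qed.

Lemma lhom_ksgnE i j (f : lhom (bm_left P) (bm_left P)) x :
  (ksgn i j f) x = ksgn i j (f x).
Proof. by case: i j => -[]. Qed.

Lemma right_mul_monoid : monoid_morphism (@right_mul S R P).
Proof.
split.
  apply: lhom_ext; apply: (homog_eq (A := D)) => [x y|x y|j x xP].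
  - exact: lhom_additive.
  - exact: lhom_additive.
  by rewrite (right_mulE (sr_grad1 R) xP) scale1r.
move=> b c; move: b; apply: (homog_eq (A := sr_grad R)) => [b b'|b b'|i b bR].
- by rewrite mulrDl right_mulD.
- by rewrite right_mulD mulrDl.
move: c; apply: (homog_eq (A := sr_grad R)) => [c c'|c c'|j c cR].
- by rewrite mulrDr right_mulD.
- by rewrite right_mulD mulrDr.
rewrite [RHS](sopp_mulE (right_mul_grad bR) (right_mul_grad cR)).
apply: lhom_ext; apply: (homog_eq (A := D)) => [x y|x y|k x xP].
- exact: lhom_additive.
- exact: lhom_additive.
rewrite lhom_ksgnE (right_mulE (sr_gradM bR cR) xP).
change (ksgn (i (+) j) k ((b * c : R^c) *: x) =
  ksgn i j (right_mul P c (right_mul P b x))).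
rewrite (right_mulE bR xP) (right_mulE cR (mem_ksgn i k (rm_gradM xP bR))).
have -> : ((b * c : R) : R^c) *: x = (c : R^c) *: ((b : R^c) *: x) by rewrite scalerA.
(* The opposite product contributes [ij], the two actions [ik] and [j(k + i)]; modulo 2 the sum is
   [(i + j)k]. *)
by rewrite /ksgn; case: i j k {bR cR xP} => -[] [] /=; rewrite ?scalerN ?opprK.
Qed.

Variable t : seq (rHom P (rreg R) * P).
Hypothesis tP : (1 : R) = \sum_(u <- t) (lin u.1 u.2 : rreg R).

(** For homogeneous [c] the sign is invertible, so [right_mul P c = 0] means that [c] annihilates
    [P]; then [c] is the sum of the [h(q) c = h(q c) = 0]. A general element reduces to its
    components because [right_mul] respects the gradings. *)
Lemma right_mul_inj : injective (@right_mul S R P).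
Proof.
have rB := morphDB right_mulD.
suff r0 b : right_mul P b = 0 -> b = 0.
  by move=> b c bc; apply/eqP; rewrite -subr_eq0; apply/eqP/r0; rewrite rB bc subrr.
have homog0 i c : c \in sr_grad R i -> right_mul P c = 0 -> c = 0.
  move=> cR c0.
  have Pc (x : P) : (c : R^c) *: x = 0.
    move: x; apply: (homog_eq (A := D)) => [x y|x y|j x xP]; first by rewrite scalerDr.
      by rewrite addr0.
    have := right_mulE cR xP; rewrite c0 => /esym/(congr1 (ksgn i j)).
    by rewrite /ksgn; case: (i && j); rewrite ?opprK ?oppr0.
  transitivity ((c : R^c) *: ((1 : R) : rreg R)); first by rewrite rreg_ractE mul1r.
  rewrite tP scaler_sumr big1 // => u _.
  by rewrite -linearZ Pc raddf0.
move=> b0; have part0 i : right_mul P (gproj (sr_grad R) i b) = 0.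
  have gP j := right_mul_grad (gprojP (sr_grad R) j b).
  have := congr1 (gproj (sr_grad (sopp (lEnd (bm_left P)))) i) b0.
  rewrite {1}(gproj_sum (sr_grad R) b) right_mulD raddfD raddf0 /=.
  by rewrite (gproj_id _ (gP false)) (gproj_id _ (gP true)); case: (i); rewrite ?addr0 ?add0r.
rewrite (gproj_sum (sr_grad R) b).
by rewrite (homog0 _ _ (gprojP _ false b)) // (homog0 _ _ (gprojP _ true b)) // addr0.
Qed.

Hypothesis P_end : bijective (@left_mul S R P).

Lemma rank1_parity i j (p : P) (g : rHom P (rreg R)) : p \in D i ->
  g \in sa_grad (rHom P (rreg R)) j -> rank1 P_end p g \in sr_grad S (i (+) j).
Proof.
move=> pP gP; apply: (parity_inj_mem left_mulD (bij_inj P_end)).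
  by move=> k s sS; rewrite addFb; exact: left_mul_parity.
rewrite end_invK; exact: rhom_comp_parity (ptmap_parity pP) gP.
Qed.

Let h e (u : rHom P (rreg R) * P) : rHom P (rreg R) := rhom_part e u.1.
Let q e (u : rHom P (rreg R) * P) : P := gproj D e u.2.

(** As 1 is even, only the terms pairing a map and an element of equal parity survive. *)
Lemma trace_homog : (1 : R) = \sum_(u <- t) \sum_(e : bool) (lin (h e u) (q e u) : rreg R).
Proof.
have E := gproj_id false (sr_grad1 R); rewrite eqxx in E.
rewrite -[LHS]E tP raddf_sum; apply: eq_bigr => u _ /=.
rewrite {1}(rhom_part_sum u.1) lin_addE raddfD big_bool addrC; congr (_ + _).
  exact: (parity_gproj true u.2 (rhom_part_mem true u.1)).
exact: (parity_gproj false u.2 (rhom_part_mem false u.1)).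
Qed.

(* With 1 = sum h(q) homogeneous, c = sum [c h] q where [c h] x := c (h x) lies in
   S, so f is determined by the values f q: f c = +- c (sum +- h (f q)). *)
Lemma right_mul_surj_homog i (f : lEnd (bm_left P)) : lhom_homog i f ->
  exists b, right_mul P b = f.
Proof.
move=> [fB fP fS]; have fD := zmod_morphD fB.
pose v e u : R := lin (h e u) (f (q e u)).
have vR e u : v e u \in sr_grad R i.
  have /rhomP hP := rhom_part_mem e u.1.
  have := hP _ _ (fP _ _ (gprojP D e u.2)).
  by rewrite addbCA addbb addbF.
(* For [c] of parity [j], the element [[c h]] of [S] has parity [j + e], so moving [f] past it costs
   the sign [i(j + e)]. The part [ij] is the sign in [right_mul]; [ei] remains and is built into
   [b]. *)
pose b : R := \sum_(u <- t) \sum_(e : bool) ksgn e i (v e u).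
have bR : b \in sr_grad R i.
  by apply: rpred_sum => u _; apply: rpred_sum => e _; exact: mem_ksgn.
exists b; apply: lhom_ext; apply: (homog_eq (A := D)) => [x y|x y|j c cP].
- exact: lhom_additive.
- exact: fD.
rewrite (right_mulE bR cP).
have cE : c = \sum_(u <- t) \sum_(e : bool) lact (rank1 P_end c (h e u)) (q e u).
  transitivity (((1 : R) : R^c) *: c); first by rewrite scale1r.
  rewrite trace_homog scaler_suml; apply: eq_bigr => u _.
  by rewrite scaler_suml; apply: eq_bigr => e _; rewrite rank1E.
rewrite [in RHS]cE (big_morph f fD (morphD0 fD)) /b scaler_suml.
rewrite (big_morph (ksgn i j) (@ksgnD _ i j) (morphD0 (@ksgnD _ i j))).
apply: eq_bigr => u _; rewrite scaler_suml (big_morph f fD (morphD0 fD)).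
rewrite (big_morph (ksgn i j) (@ksgnD _ i j) (morphD0 (@ksgnD _ i j))).
apply: eq_bigr => e _.
have rS := rank1_parity cP (rhom_part_mem e u.1).
rewrite [RHS](fS _ _ (q e u) rS).
have -> : (rank1 P_end c (h e u) : S) *: (f (q e u) : bm_left P) =
    (v e u : R^c) *: c by rewrite -[LHS]/(lact _ _) rank1E.
by rewrite /ksgn; case: i j e {fP fS vR bR cP rS b cE} => -[] [] /=; rewrite ?scaleNr ?opprK.
Qed.

Lemma right_mul_iso : super_ring_iso (@right_mul S R P).
Proof.
split; [exact: (morphDB right_mulD)|exact: right_mul_monoid| |exact: right_mul_grad].
apply: inj_surj_bij => [|f]; first exact: right_mul_inj.
pose G := sa_grad (lHom (bm_left P) (bm_left P)).
have surj i : exists b, right_mul P b = gproj G i f.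
  by apply: (@right_mul_surj_homog i); apply/asboolP; exact: (gprojP G i f).
have [b0 b0E] := surj false; have [b1 b1E] := surj true.
by exists (b0 + b1); rewrite right_mulD b0E b1E -gproj_sum.
Qed.
End DoubleCentralizer.

(** * The correspondence and its compatibility with composition *)

Lemma equivalence_progenerator (S R : superRing)
    (F : superfunctor (sMod S) (sMod R)) (P : bimod S R) :
  sf_equivalence F -> super_nat_iso F (tensor_functor P) -> bimod_progenerator P.
Proof.
move=> [F_ff F_es] [eta [etaI etaN]].
(* The isomorphism at the regular module, followed by [S (x)_S P = P]. Naturality at left
   multiplications, odd ones included, makes it left linear, so the properties of [F(S)] pass to
   [P]. *)
pose phi : even_hom (C := sMod R) (F (rreg S)) P :=
  even_comp (mk_even (tensor_unit_even P)) (eta (rreg S)).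
have phi_bij : bijective (lin (val phi)).
  have [g [gK Kg]] := cat_isoK (etaI (rreg S)).
  apply: (bij_comp (f := lin (tensor_unit P)) (h := lin (val (eta (rreg S))))).
    by exists (@tensor_unit_inv _ _ P); [exact: tensor_unitK|exact: tensor_unit_invK].
  by exists (lin (val g)).
have phi_lact s x : lin (val phi) (image_lact (F := F) s x) = lact s (lin (val phi) x).
  rewrite -[RHS]tensor_unit_lact; congr (lin (tensor_unit P) _).
  exact: (congr1 (fun h : rHom (F (rreg S)) (tensor (rreg S) P) => lin h x)
    (etaN _ _ (ptmap (s : rreg S)))).
have P_end := left_mul_bij F_ff phi_bij phi_lact.
have P_gen := generator_even_iso phi_bij (image_generator F_ff F_es).
have [s /(dual_basis_even_iso phi_bij) [s' s'P]] := image_dual_basis F_ff F_es.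
have [t tP] := generator_trace P_gen.
split; first by split; [exact: left_mul_iso|exact: right_mul_iso tP P_end].
by split=> //; [exact: dual_basis_fg s'P|exact: dual_basis_projective s'P].
Qed.

Lemma sf_equivalence_comp (S R T : superRing) (F : superfunctor (sMod S) (sMod R))
    (G : superfunctor (sMod R) (sMod T)) :
  sf_equivalence F -> sf_equivalence G -> sf_equivalence (superfunctor_comp G F).
Proof.
move=> [Fff Fes] [Gff Ges]; split=> [X Y|Z].
  exact: (bij_comp (Gff (F X) (F Y)) (Fff X Y)).
have [Y [g gb]] := Ges Z; have [X [f fb]] := Fes Y.
exists X, (even_comp g (fun_hom (even_functor G) f : even_hom (C := sMod T) (G (F X)) (G Y))).
have [f' [fK f'K]] := even_iso_inv fb.
apply: (bij_comp (f := lin (val g)) (h := lin (sf_hom G (val f)))) => //.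
have E1 : rcomp f' (val f) = @sc_id (sMod R) (F X) by exact: linear_ext.
have E2 : rcomp (val f) f' = @sc_id (sMod R) Y by exact: linear_ext.
exists (lin (sf_hom G f')) => x; rewrite -sf_compE ?E1 ?E2.
  by rewrite (sf_id G).
by rewrite (sf_id G).
Qed.

Theorem theorem3p2p6 (R S : superRing) :
  [/\ (* P |-> - (x)_S P sends progenerators to equivalences, *)
      forall P : bimod S R, bimod_progenerator P ->
        module_equivalence (tensor_functor P),
      (* and is well defined and injective on isomorphism classes *)
      forall P Q : bimod S R, bimod_progenerator P -> bimod_progenerator Q ->
        (bimod_iso P Q <-> super_nat_iso (tensor_functor P) (tensor_functor Q)),
      (* and surjective; *)
      forall F : superfunctor (sMod S) (sMod R), module_equivalence F ->
        exists P : bimod S R,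
          bimod_progenerator P /\ super_nat_iso F (tensor_functor P)
    & (* composition corresponds to the tensor product. *)
      forall (T : superRing)
        (F : superfunctor (sMod S) (sMod R)) (G : superfunctor (sMod R) (sMod T))
        (P : bimod S R) (P' : bimod R T),
        module_equivalence F -> module_equivalence G ->
        bimod_progenerator P -> bimod_progenerator P' ->
        super_nat_iso F (tensor_functor P) ->
        super_nat_iso G (tensor_functor P') ->
        [/\ module_equivalence (superfunctor_comp G F),
            bimod_progenerator (tensor_bimod P P') &
            super_nat_iso (superfunctor_comp G F)
              (tensor_functor (tensor_bimod P P'))]].
Proof.
split=> [P /progenerator_equivalence|P Q _ _|F FE|T F G P P' FE GE _ _ FP GP'].
- exact: sf_module_equivalence.
- by split; [exact: bimod_iso_tensor|exact: tensor_bimod_iso].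
- have sFE := module_equivalence_sf FE; have [F_ff F_es] := sFE.
  have FP := image_tensor_iso F_ff F_es.
  by exists (image_bimod F); split=> //; exact: equivalence_progenerator sFE FP.
have GFE := sf_equivalence_comp (module_equivalence_sf FE) (module_equivalence_sf GE).
(* Associativity exhibits [P (x)_R P'] as the bimodule of the composite equivalence, from which it
   inherits the progenerator property. *)
have GFP : super_nat_iso (superfunctor_comp G F) (tensor_functor (tensor_bimod P P')).
  apply: super_nat_iso_trans (super_nat_iso_comp FP GP') _.
  exact: super_nat_iso_sym (tensor_assoc_iso P P').
by split=> //; [exact: sf_module_equivalence|exact: equivalence_progenerator GFE GFP].
Qed.
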